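(* Let $\mathbb{K} = \mathbb{C}$ or $\mathbb{R}$ and let $f \colon \mathbb{K}^2 \to \mathbb{K}$ be a polynomial of degree $d$ with $f(0) = 0$. Then $$\mathscr{L}(f) \le 1 - \frac{1}{(d-1)^2 + 1},$$ where $\mathscr{L}(f)$ is the {\L}ojasiewicz gradient exponent of $f$ at the origin.
   Context: The polynomial $f$ is nonzero (so $d \ge 1$). The {\L}ojasiewicz gradient exponent $\mathscr{L}(f)$ of $f$ at the origin is the minimum of the exponents $\ell \ge 0$ for which there are constants $c, \epsilon > 0$ with $\|\nabla f(z)\| \ge c\,|f(z)|^{\ell}$ for all $z \in \mathbb{K}^2$ with $\|z\| < \epsilon$, where $\nabla f$ is the vector of partial derivatives (this minimum exists and is a rational number in $[0,1)$). *)

(* Defs.v *)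
From mathcomp Require Import all_boot all_order all_algebra.
From mathcomp Require Import complex mpoly reals.
From mathcomp.analysis Require exp.

Set Implicit Arguments.
Unset Strict Implicit.
Unset Printing Implicit Defensive.

Import Order.TTheory GRing.Theory Num.Theory.

Local Open Scope ring_scope.

(* [abs : K -> R] is the absolute value of K, real-valued: it is [Num.norm]
   for K = R, and [Normc.normc] (rather than the R[i]-valued [Num.norm])
   for K = R[i]. *)
Definition l2norm (R : realType) (K : Type) (abs : K -> R) (n : nat)
    (v : 'I_n -> K) : R :=
  Num.sqrt (\sum_(i < n) abs (v i) ^+ 2).

Definition gradient (K : comNzRingType) (n : nat) (f : {mpoly K[n]})
    (z : 'I_n -> K) : 'I_n -> K :=
  fun i => (f^`M(i)).@[z].

(* The power is that of [powR], so 0 to the power 0 is 1 and 0 to the power l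
   is 0 for l > 0. *)
Definition gradient_inequality (R : realType) (K : comNzRingType)
    (abs : K -> R) (n : nat) (f : {mpoly K[n]}) (l : R) : Prop :=
  exists c eps : R, [/\ 0 < c, 0 < eps &
    forall z : 'I_n -> K, l2norm abs z < eps ->
      c * exp.powR (abs f.@[z]) l <= l2norm abs (gradient f z)].

Definition is_lojasiewicz_exponent (R : realType) (K : comNzRingType)
    (abs : K -> R) (n : nat) (f : {mpoly K[n]}) (L : R) : Prop :=
  [/\ 0 <= L, gradient_inequality abs f L &
    forall l : R, 0 <= l -> gradient_inequality abs f l -> L <= l].

(* Main.v *)
Require Import Defs.
From mathcomp Require Import all_boot all_order all_algebra.
From mathcomp Require Import complex mpoly reals.
From mathcomp.analysis Require exp.
From mathcomp Require Import ring lra zify.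

(** Real case: a real polynomial can be read as a complex one with the same
    values and the same gradient norm at real points, so the complex inequality
    restricts to it. It remains to prove, for complex f of degree d with
    N = (d-1)^2, that |f|^N <= c |grad f|^(N+1) near the origin; the minimality
    of L then gives L <= N/(N+1).

    After a linear change x -> x + lam y the polynomial P(x,y) obtained from f
    is monic in y up to a constant, of degree d, and the restriction P(0,y) has
    the order m of f at 0. If m = 1 the gradient does not vanish at 0. Otherwise
    let F be the monic multiple of dP/dy, of degree K = d-1 in y. The zero set
    of F is a polar curve of f, and everything is compared with it. Fix a small
    point z0 = (x,y0), let G be the size of the gradient of P at z0, and let y1
    be the root of F(x,.) nearest to y0, with r = |y0-y1|. The facts that carry
    the proof are these.

    - Vertical comparison. Since y1 is the nearest root, the Taylor
      coefficients of dP/dy at y1 are controlled by its value at z0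
      (taylor_maj_root): |P(z0) - P(x,y1)| <= c r |dP/dy(z0)|, and
      r^K <= c |dP/dy(z0)| because F(x,.) is monic.

    - Bezout. The characteristic polynomial of dP/dx on the roots of F(x,.) has
      coefficients of degree at most K^2 = N in x, because roots grow linearly
      and dP/dx like the power K at infinity. Looking at the lowest nonzero
      coefficient, dP/dx at a root is either 0 or at least c |x|^N (root_gap).
      In the same way P at a root is either 0 or at least c |x|^(dK).

    - Newton-Puiseux. Modulo any power of t, F(t^e,y) splits into factors
      y - phi(t) (puiseux, by Hensel lifting), so y1 is within c |x|^n of a
      polynomial branch w = phi(t), t^e = x, for n as large as desired
      (polar_approx). Along a branch u(t) = P(t^e,phi(t)) is a polynomial with
      u(0) = 0, hence |u| <= c |t u'|, and the chain rule expresses t u' by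
      dP/dx and dP/dy, even at the shifted point (x, phi(t) + rho), up to terms
      controlled by Taylor coefficients (branch_estimate). The change of
      coordinates makes phi divisible by t^e (branch_slope), so that the term
      t phi'(t) dP/dy is of size |x| |dP/dy|.

    Suppose P(x,y1) <> 0; otherwise the vertical comparison suffices. By the
    gap, the error |x|^n is negligible against P(x,y1), and the branch estimate
    gives |P(z0)| <= c (|x|+r) G and |x| |dP/dx(x,y1)| <= c (|x|+r) G, with
    |dP/dx(x,y1)| >= c |x|^N. If r <= |x| this says |x|^N <= c G; if r >= |x|
    then r^N = (r^K)^K <= c G. In both cases (|x|+r)^N <= c G, whence
    |P(z0)|^N <= c (|x|+r)^N G^N <= c G^(N+1).

    Only polynomial algebra and explicit estimates are used. A phrase such as
    for small z is always encoded as c |z| <= 1 with the same constant c >= 1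
    that occurs in the conclusion: such statements are monotone in c, so that
    finitely many of them can be merged by adding the constants. *)

Set Implicit Arguments.
Unset Strict Implicit.
Unset Printing Implicit Defensive.

Import Order.TTheory GRing.Theory Num.Theory.

Local Open Scope ring_scope.

(* Otherwise simplification exposes square roots of coordinates. *)
Arguments Normc.normc : simpl never.

(** * Bivariate polynomials and Hensel's lemma *)

(** In {poly {poly A}} the outer variable is y and the inner one is x (or t).
    Specializing x gives a polynomial in y. *)
Notation fiber x := (map_poly (horner_eval x)).
(** Ramified base change: x is replaced by the e-th power of the parameter. *)
Notation ram e := (map_poly (comp_poly 'X^e)).

Lemma coef_fiber (A : comNzRingType) (x : A) (P : {poly {poly A}}) j :
  (fiber x P)`_j = (P`_j).[x].
Proof. by rewrite coef_map. Qed.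

(** Congruence modulo t^n in (K[t])[y]; it stands in for power series in t,
    of which only truncations are needed. *)
Definition cong (K : fieldType) (n : nat) (P Q : {poly {poly K}}) : Prop :=
  exists E : {poly {poly K}}, P = Q + ('X^n)%:P * E.

Section Congruence.
Variable K : fieldType.
Implicit Types (P Q E : {poly {poly K}}) (p q : {poly K}).

Lemma congP n P Q :
  cong n P Q <-> forall j, exists e, P`_j = Q`_j + 'X^n * e.
Proof.
split=> [[E ->] j|H]; first by exists E`_j; rewrite coefD coefCM.
exists (map_poly (drop_poly n) (P - Q)).
apply/polyP => j; rewrite coefD coefCM coef_map coefB /=.
have [e ->] := H j.
have -> : Q`_j + 'X^n * e - Q`_j = e * 'X^n by ring.
by rewrite drop_polyMXn_id mulrC.
Qed.

Lemma cong_refl n P : cong n P P.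
Proof. by exists 0; rewrite mulr0 addr0. Qed.

Lemma cong_mul n P P' Q Q' :
  cong n P Q -> cong n P' Q' -> cong n (P * P') (Q * Q').
Proof.
move=> [E ->] [E' ->]; exists (E * Q' + Q * E' + ('X^n)%:P * E * E').
ring.
Qed.

Lemma cong_trans n P Q S : cong n P Q -> cong n Q S -> cong n P S.
Proof. by move=> [E ->] [E' ->]; exists (E' + E); ring. Qed.

Lemma cong_comp n P Q S : cong n P Q -> cong n (P \Po S) (Q \Po S).
Proof.
move=> [E ->]; exists (E \Po S).
by rewrite comp_polyD comp_polyM comp_polyC.
Qed.

Lemma cong_ram n e P Q : cong n P Q -> cong (e * n) (ram e P) (ram e Q).
Proof.
move=> [E ->]; exists (ram e E).
by rewrite rmorphD rmorphM /= map_polyC /= comp_Xn_poly -exprM mulnC.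
Qed.

Lemma fiber_lift (x : K) (p : {poly K}) : fiber x (p^:P) = p.
Proof. by apply/polyP => j; rewrite coef_fiber coef_map /= hornerC. Qed.

Lemma fiber0_eq0 P : fiber 0 P = 0 -> exists E, P = 'X%:P * E.
Proof.
move=> P0; exists (map_poly (drop_poly 1) P).
apply/polyP => j; rewrite coefCM coef_map /=.
rewrite -[in LHS](poly_take_drop 1 P`_j) mulrC expr1.
rewrite [take_poly 1 _](_ : _ = 0) ?add0r //.
apply/polyP => i; rewrite coef_take_poly coef0; case: i => //=.
by rewrite -horner_coef0 -coef_fiber P0 coef0.
Qed.

Lemma fiber_monic (x : K) P :
  P \is monic -> fiber x P \is monic /\ size (fiber x P) = size P.
Proof.
move=> mP; split; first exact: monic_map.
rewrite size_map_poly_id0 //= (monicP mP) /horner_eval hornerC.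
exact: oner_neq0.
Qed.

Lemma size_lift (p : {poly K}) : size (p^:P) = size p.
Proof. by rewrite size_map_poly. Qed.

(** The size bounds come from reducing the Bezout cofactor modulo g; then the
    other cofactor is small because e is. *)
Lemma bezout_split (g h e : {poly K}) :
    g \is monic -> h \is monic -> coprimep g h ->
    (size e < size g + size h - 1)%N ->
  exists a b : {poly K}, [/\ (size a < size g)%N, (size b < size h)%N & e = a * h + b * g].
Proof.
move=> mg mh /Bezout_eq1_coprimepP [[u v] /= uv] se.
have g0 := monic_neq0 mg; have h0 := monic_neq0 mh.
pose a : {poly K} := (v * e) %% g; pose b : {poly K} := (v * e) %/ g * h + u * e.
have sa : (size a < size g)%N by rewrite /a ltn_modp.
have E : e = a * h + b * g.
  transitivity (v * e * h + u * e * g); first by rewrite -[LHS]mul1r -uv; ring.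
  by rewrite /a /b {1}(divp_eq (v * e) g); ring.
exists a, b; split=> //.
rewrite ltnNge; apply/negP => sb.
have b0 : b != 0.
  by apply: contraTneq sb => ->; rewrite size_poly0 -ltnNge lt0n size_poly_eq0.
have hp : (0 < size h)%N by rewrite size_poly_gt0.
have bp : (0 < size b)%N by rewrite size_poly_gt0.
have sbg : size (b * g) = (size b + size g).-1 by rewrite size_Mmonic.
have sah : (size (a * h)%R < size (b * g)%R)%N.
  apply: leq_ltn_trans (size_polyMleq _ _) _; rewrite sbg.
  have aux (A B G H : nat) : (A < G -> H <= B -> 0 < H -> (A + H).-1 < (B + G).-1)%N by lia.
  exact: aux sa sb hp.
have : size e = size (b * g) by rewrite E addrC size_polyDl.
rewrite sbg.
have aux (A B G H : nat) :
  (A < G + H - 1 -> H <= B -> 0 < H -> A = (B + G).-1 -> False)%N by lia.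
exact: aux se sb hp.
Qed.

(** Induction on n: the error of a factorization modulo t^n is t^n E, and
    splitting E(0,y) by Bezout tells how to correct both factors. The bounds on
    the sizes of the corrections keep the factors monic of the same degree. *)
Lemma hensel (F : {poly {poly K}}) (g h : {poly K}) (n : nat) :
    F \is monic -> fiber 0 F = g * h -> g \is monic -> h \is monic ->
    coprimep g h ->
  exists G H, [/\ G \is monic, H \is monic, size G = size g, size H = size h &
    cong n F (G * H)].
Proof.
move=> mF Fgh mg mh cgh.
have g0 := monic_neq0 mg; have h0 := monic_neq0 mh.
have sF : size F = (size g + size h - 1)%N.
  have [_ <-] := fiber_monic 0 mF.
  by rewrite Fgh size_Mmonic // subn1.
suff [G [H [mG mH sG sH [G0 [H0 [E ->]]]]]]: exists G H : {poly {poly K}},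
  [/\ G \is monic, H \is monic, size G = size g, size H = size h &
      [/\ fiber 0 G = g, fiber 0 H = h & cong n.+1 F (G * H)]].
  exists G, H; split=> //; exists ('X%:P * E); rewrite exprSr polyCM; ring.
elim: n => [|n [G [H [mG mH sG sH [G0 H0 [E FE]]]]]].
  exists g^:P, h^:P; rewrite !size_lift !monic_map //; split=> //.
  rewrite !fiber_lift; split => //.
  have [|E HE] := @fiber0_eq0 (F - g^:P * h^:P).
    by rewrite rmorphB rmorphM /= !fiber_lift Fgh subrr.
  by exists E; rewrite -HE; ring.
have X0 k : ('X^k : {poly K}) != 0 by rewrite expf_neq0 // polyX_eq0.
have sE : (size (fiber (0 : K) E) < size g + size h - 1)%N.
  apply: (leq_ltn_trans (size_poly _ _)).
  have <- : size (('X^(n.+1))%:P * E)%R = size E.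
    by rewrite mul_polyC size_scale.
  have -> : ('X^(n.+1))%:P * E = F - G * H by rewrite FE; ring.
  have [->|FN0] := eqVneq (F - G * H) 0.
    rewrite size_poly0 -sF lt0n size_poly_eq0; exact: monic_neq0.
  have mGH : G * H \is monic by rewrite monicMl.
  have sGH : size (G * H) = size F.
    by rewrite sF size_Mmonic ?monic_neq0 // sG sH subn1.
  rewrite -sF.
  have : (size (F - G * H)%R <= size F)%N.
    by rewrite (leq_trans (size_polyD _ _)) // size_polyN sGH maxnn.
  rewrite leq_eqVlt => /orP [/eqP sE|//].
  have : lead_coef (F - G * H) = 0.
    rewrite lead_coefE coefB sE -{2}sGH -!lead_coefE (monicP mF) (monicP mGH).
    by rewrite subrr.
  by move/eqP; rewrite lead_coef_eq0 (negPf FN0).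
have [a [b [sa sb Eab]]] := bezout_split mg mh cgh sE.
pose G' := G + ('X^(n.+1))%:P * a^:P; pose H' := H + ('X^(n.+1))%:P * b^:P.
have szlt (p : {poly K}) : size (('X^(n.+1))%:P * p^:P)%R = size p.
  by rewrite mul_polyC size_scale // size_lift.
have sG' : size G' = size g by rewrite size_polyDl // szlt sG.
have sH' : size H' = size h by rewrite size_polyDl // szlt sH.
have mG' : G' \is monic by rewrite monicE lead_coefDl ?szlt ?sG // -monicE.
have mH' : H' \is monic by rewrite monicE lead_coefDl ?szlt ?sH // -monicE.
have fX (p : {poly K}) : fiber (0 : K) (('X^(n.+1))%:P * p^:P) = 0.
  by rewrite rmorphM /= map_polyC /= /horner_eval hornerXn expr0n /= polyC0 mul0r.
exists G', H'; split=> //; split.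
- by rewrite rmorphD /= fX addr0.
- by rewrite rmorphD /= fX addr0.
have [|E' HE'] := @fiber0_eq0 (E - a^:P * H - b^:P * G).
  by rewrite !rmorphB !rmorphM /= !fiber_lift G0 H0 Eab; ring.
exists (E' - ('X^n)%:P * a^:P * b^:P).
have -> : F = G * H + ('X^(n.+1))%:P * ('X%:P * E' + a^:P * H + b^:P * G).
  by rewrite FE -HE'; ring.
rewrite /G' /H' !exprS !polyCM; ring.
Qed.

End Congruence.

(** * The Newton-Puiseux theorem modulo powers of t *)

Lemma coef_comp_polyXaddC (A : comNzRingType) (p : {poly A}) (c : A) i :
  (p \Po ('X + c%:P))`_i = (p^`N(i)).[c].
Proof.
rewrite /comp_poly addrC nderiv_taylor; last exact: mulrC.
have Hi j : (p^:P)^`N(j).[c%:P] = ((p^`N(j)).[c])%:P.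
  by rewrite nderivn_map horner_map.
rewrite coef_sum; under eq_bigr do rewrite Hi coefCM coefXn.
rewrite size_map_polyC.
case: (ltnP i (size p)) => ip.
  rewrite (bigD1 (Ordinal ip)) //= eqxx mulr1 big1 ?addr0 // => j.
  by rewrite -val_eqE /= eq_sym => /negPf ->; rewrite mulr0.
rewrite big1 => [|j _]; last first.
  by rewrite (_ : (i == j) = false) ?mulr0 //; have := ltn_ord j; lia.
suff -> : p^`N(i) = 0 by rewrite horner0.
by apply/polyP => j; rewrite coef_nderivn nth_default ?mul0rn ?coef0 // (leq_trans ip) ?leq_addr.
Qed.

Section Puiseux.
Variable C : numClosedFieldType.
Implicit Types (P Q E F : {poly {poly C}}) (q : {poly C}).

Lemma poly_Xn_factor (p : {poly C}) : p != 0 -> exists v q, p = 'X^v * q /\ q.[0] != 0.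
Proof.
move=> p0; have [v [q]] := multiplicity_XsubC p 0.
rewrite p0 /= subr0 => q0 ->; exists v, q; split; first by rewrite mulrC.
exact: q0.
Qed.

Lemma dvdXn_factor n v q : q.[0] != 0 -> (exists e, 'X^v * q = 'X^n * e) -> (n <= v)%N.
Proof.
move=> q0 [e He]; rewrite leqNgt; apply: contra q0 => vn.
have : 'X^v * q = 'X^v * ('X^(n - v) * e) by rewrite mulrA -exprD subnKC // ltnW.
move/(mulfI (_ : 'X^v != 0)) => -> //; last by rewrite expf_neq0 // polyX_eq0.
rewrite hornerM hornerXn expr0n subn_eq0 leqNgt vn /=; apply/eqP; ring.
Qed.

Lemma dvdXn_case n q : (exists e, q = 'X^n * e) \/
  exists v q', [/\ (v < n)%N, q = 'X^v * q' & q'.[0] != 0].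
Proof.
have [->|q0] := eqVneq q 0; first by left; exists 0; rewrite mulr0.
have [v [q' [-> q'0]]] := poly_Xn_factor q0.
case: (ltnP v n) => vn; first by right; exists v, q'.
by left; exists ('X^(v - n) * q'); rewrite mulrA -exprD subnKC.
Qed.

(** The steepest side of the Newton polygon. After x = t^L with L = k! all
    slopes become integers, so there is a largest p such that t^(p (k - j))
    divides the coefficient of y^j for every j; dividing out yields G, and by
    maximality of p the special fiber G(0,y) is not y^k. *)
Lemma blow_up F k :
    F \is monic -> size F = k.+1 -> F`_k.-1 = 0 -> F != 'X^k -> 
  exists (L p : nat) (G : {poly {poly C}}), [/\ (0 < L)%N, G \is monic, size G = k.+1,
     forall j, (j <= k)%N -> (ram L F)`_j = 'X^(p * (k - j)) * G`_j &
     exists2 j, (j < k)%N & (G`_j).[0] != 0].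
Proof.
move=> mF sF Fk1 Fk.
have Fkk : F`_k = 1 by have /monicP := mF; rewrite lead_coefE sF.
(* Every k - j with j < k divides L, so all slopes become integral. *)
pose L := k`!%N; have L0 : (0 < L)%N by rewrite fact_gt0.
have LX j : (ram L F)`_j = F`_j \Po 'X^L by rewrite coef_map.
pose A (p : nat) := [forall j : 'I_k, 'X^(p * (k - j)) %| (ram L F)`_j].
have [j0 j0k Fj0] : exists2 j, (j < k)%N & F`_j != 0.
  case: (boolP [exists j : 'I_k, F`_j != 0]) => [/existsP [j Hj]|]; first by exists j.
  rewrite negb_exists => /forallP H; case/eqP: Fk; apply/polyP => j.
  rewrite coefXn; case: (ltngtP j k) => jk; last by rewrite jk Fkk.
    by have := H (Ordinal jk); rewrite negbK => /eqP.
  by rewrite nth_default // sF.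
have vF j : (j < k)%N -> F`_j != 0 -> exists s q, (ram L F)`_j = 'X^(s * (k - j)) * q /\ q.[0] != 0.
  move=> jk /poly_Xn_factor [v [q [Fj q0]]].
  have : (k - j %| L)%N by apply: dvdn_fact; lia.
  case/dvdnP => s Ls; exists (s * v)%N, (q \Po 'X^L); split; last first.
    by rewrite horner_comp hornerXn expr0n eqn0Ngt L0.
  rewrite LX Fj comp_polyM comp_Xn_poly -exprM Ls; congr ('X^_ * _); lia.
have Adv (p : nat) : A p -> forall j, (j < k)%N -> exists e, (ram L F)`_j = 'X^(p * (k - j)) * e.
  by move=> /forallP H j jk; have /dvdpP [e He] := H (Ordinal jk); exists e; rewrite He mulrC.
have A0 : A 0%N by apply/forallP => j; rewrite mul0n expr0 dvd1p.
have [s0 [q0 [Hs0 q00]]] := vF _ j0k Fj0.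
have Abd (p : nat) : A p -> (p <= s0)%N.
  move=> /Adv /(_ _ j0k); rewrite Hs0 => /(dvdXn_factor q00).
  by rewrite leq_pmul2r // subn_gt0.
have exA : exists p, A p by exists 0%N.
case: (ex_maxnP exA Abd) => p /Adv Ap pmax.
have [|nex] := boolP [exists j : 'I_k, ~~ ('X^(p.+1 * (k - j)) %| (ram L F)`_j)]; last first.
  move: nex; rewrite negb_exists => /forallP H; have /pmax : A p.+1; last by rewrite ltnn.
  by apply/forallP => j; have := H j; rewrite negbK.
case/existsP => j1 nj1.
pose G := ('X^k + \poly_(j < k) drop_poly (p * (k - j)) (ram L F)`_j).
have Gj j : (j < k)%N -> (ram L F)`_j = 'X^(p * (k - j)) * G`_j.
  move=> jk; rewrite /G coefD coefXn coef_poly jk ltn_eqF // add0r.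
  by have [e ->] := Ap _ jk; rewrite [X in drop_poly _ X]mulrC drop_polyMXn_id.
have sp : (size (\poly_(j < k) drop_poly (p * (k - j)) (ram L F)`_j) < size ('X^k : {poly {poly C}}))%N.
  by rewrite size_polyXn ltnS size_poly.
exists L, p, G; split=> //.
- by rewrite /G monicE lead_coefDl // lead_coefXn.
- by rewrite /G size_polyDl // size_polyXn.
- move=> j; rewrite leq_eqVlt => /orP [/eqP ->|]; last exact: Gj.
  rewrite subnn muln0 expr0 mul1r LX Fkk /G coefD coefXn eqxx.
  by rewrite coef_poly ltnn addr0 comp_polyC.
exists j1; first exact: ltn_ord.
have Fj1 : F`_j1 != 0.
  by apply: contraNneq nj1 => Fj1; rewrite LX Fj1 comp_poly0 dvdp0.
have kj : (0 < k - j1)%N by rewrite subn_gt0.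
have [s [q [Hs qn0]]] := vF _ (ltn_ord j1) Fj1.
have sp1 : (s <= p)%N.
  rewrite -ltnS -(ltn_pmul2r kj) ltnNge; apply: contra nj1 => le.
  by rewrite Hs dvdp_mulr // dvdp_exp2l.
have ps : (p <= s)%N.
  rewrite -(leq_pmul2r kj); apply: dvdXn_factor qn0 _.
  by have [e He] := Ap _ (ltn_ord j1); exists e; rewrite -Hs.
have sp2 : s = p by apply/eqP; rewrite eqn_leq sp1.
have := Gj _ (ltn_ord j1); rewrite Hs sp2 => /mulfI <- //.
by rewrite expf_neq0 // polyX_eq0.
Qed.

(** If the y^(k-1) coefficient vanishes and f is not y^k, then f is not the
    k-th power of a linear factor, since that factor could only be y. So a root
    of f splits off with its full multiplicity and leaves a coprime factor. *)
Lemma split_fiber (f : {poly C}) k :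
    f \is monic -> size f = k.+1 -> f`_k.-1 = 0 ->
    (exists2 j, (j < k)%N & f`_j != 0) ->
  exists g h, [/\ g \is monic, h \is monic, coprimep g h, f = g * h &
     (size g <= k)%N /\ (size h <= k)%N].
Proof.
move=> mf sf fk1 [j jk fj].
have k0 : (0 < k)%N by apply: leq_ltn_trans jk.
have [c rc] : exists c, root f c by apply/closed_rootP; rewrite sf eqSS -lt0n.
have [m [q]] := multiplicity_XsubC f c; rewrite monic_neq0 //= => qc Ef.
have mX : ('X - c%:P) ^+ m \is monic by rewrite monic_exp ?monicXsubC.
have mq : q \is monic by rewrite -(monicMr _ mX) -Ef.
have sX : size (('X - c%:P) ^+ m) = m.+1 by rewrite size_exp_XsubC.
have m0 : (0 < m)%N.
  by rewrite lt0n; apply: contraTneq rc => m0; rewrite Ef m0 expr0 mulr1.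
have sq : (size q + m = k.+1)%N.
  by rewrite -sf Ef size_Mmonic ?monic_neq0 // sX addnS.
exists q, (('X - c%:P) ^+ m); split=> //; last first.
  have q0 : (0 < size q)%N by rewrite size_poly_gt0 monic_neq0.
  have aux1 (a b n : nat) : (a + b = n.+1 -> 0 < b -> a <= n)%N by lia.
  have aux2 (a b n : nat) : (a + b = n.+1 -> 0 < a -> b <= n)%N by lia.
  split; first exact: aux1 sq m0.
  rewrite sX ltn_neqAle (aux2 _ _ _ sq q0) andbT.
  apply: contraNneq fj => mk.
  have sq1 : size q = 1%N by move: sq; rewrite mk -add1n => /addIn.
  have q1 : q = 1.
    by have := monicP mq; rewrite [q]size1_polyC ?sq1 // lead_coefC => ->.
  move: fk1; rewrite Ef q1 mul1r mk.
  have -> : ('X - c%:P) ^+ k = ('X^k \Po ('X + (- c)%:P)).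
    by rewrite comp_Xn_poly polyCN.
  have Hc i : ('X^k \Po ('X + (- c)%:P))`_i = (- c) ^+ (k - i) *+ 'C(k, i).
    by rewrite coef_comp_polyXaddC nderivnXn hornerMn hornerXn.
  rewrite !Hc => /eqP; rewrite mulrn_eq0 -leqn0 leqNgt bin_gt0 leq_pred /=.
  rewrite expf_eq0 oppr_eq0 => /andP [_ /eqP ->].
  by rewrite oppr0 expr0n subn_eq0 leqNgt jk mul0rn.
by rewrite coprimep_expr // coprimep_XsubC.
Qed.

(** Undoing the blow-up: scaling the roots by c weights the coefficients. *)
Lemma coef_prod_scale (A : idomainType) (c : A) (s : seq A) j :
  (j <= size s)%N ->
  (\prod_(a <- s) ('X - (c * a)%:P))`_j =
    c ^+ (size s - j) * (\prod_(a <- s) ('X - a%:P))`_j.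
Proof.
elim: s j => [|a s IH] j; first by rewrite !big_nil; case: j => //=; rewrite expr0 mul1r.
rewrite !big_cons !mulrBl !coefB !coefCM !coefXM /=.
rewrite leq_eqVlt => /orP [/eqP ->|].
  have Z (t : seq A) : size t = size s -> (\prod_(b <- t) ('X - b%:P))`_(size s).+1 = 0.
    by move=> st; rewrite nth_default // size_prod_XsubC st.
  have Zc : (\prod_(b <- s) ('X - (c * b)%:P))`_(size s).+1 = 0.
    by have := Z [seq c * b | b <- s]; rewrite size_map big_map => ->.
  by rewrite /= IH // Zc Z // !subnn !expr0; ring.
case: j => [|j] js /=; rewrite ?IH //; last by lia.
  by rewrite !sub0r !subn0 exprS; ring.
by rewrite subSS (_ : (size s - j = (size s - j.+1).+1)%N) ?exprS; [ring|lia].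
Qed.

Lemma ram_ram e L F : ram e (ram L F) = ram (L * e) F.
Proof.
apply/polyP => j; rewrite !coef_map /= -comp_polyA comp_Xn_poly -exprM.
by rewrite mulnC.
Qed.

Lemma ram_prod e (s : seq {poly C}) :
  ram e (\prod_(p <- s) ('X - p%:P)) = \prod_(p <- [seq p \Po 'X^e | p <- s]) ('X - p%:P).
Proof.
rewrite rmorph_prod big_map; apply: eq_bigr => p _.
by rewrite rmorphB /= map_polyX map_polyC.
Qed.

(** Induction on the degree k. After a Tschirnhausen shift the coefficient of
    y^(k-1) is zero; the blow-up then has a special fiber with two coprime
    factors, Hensel's lemma lifts them, and the induction hypothesis applies to
    both. The precision is e * n because t^e is the original variable: the
    congruence is modulo x^n. *)
Theorem puiseux k : forall F, F \is monic -> size F = k.+1 ->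
  forall n, exists e (s : seq {poly C}), [/\ (0 < e)%N, size s = k &
    cong (e * n) (ram e F) (\prod_(p <- s) ('X - p%:P))].
Proof.
elim/ltn_ind: k => k IH F mF sF n.
case: (posnP k) => [k0|k0].
  exists 1%N, [::]; split=> //; rewrite big_nil.
  have -> : F = 1.
    by have := monicP mF; rewrite [F]size1_polyC ?sF ?k0 // lead_coefC => ->.
  by rewrite rmorph1; apply: cong_refl.
(* The shift that makes the sum of the roots vanish. *)
pose c := - (k%:R^-1 *: F`_k.-1); pose F1 := F \Po ('X + c%:P).
have kK : (k%:R : C) != 0 by rewrite pnatr_eq0 -lt0n.
have Fk : F`_k = 1 by have /monicP := mF; rewrite lead_coefE sF.
have F1k : F1`_k = 1.
  rewrite coef_comp_polyXaddC [_^`N(k)]size1_polyC ?hornerC.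
    by rewrite coef_nderivn addn0 binn Fk.
  by apply/leq_sizeP => j j1; rewrite coef_nderivn nth_default ?mul0rn // sF; lia.
have sF1 : size F1 = k.+1.
  by rewrite size_comp_poly2 // size_XaddC.
have mF1 : F1 \is monic by rewrite monicE lead_coefE sF1 F1k.
have F1k1 : F1`_k.-1 = 0.
  rewrite coef_comp_polyXaddC.
  have -> : F^`N(k.-1) = (F`_k.-1)%:P + (k%:R)%:P * 'X.
    apply/polyP => j; rewrite coef_nderivn coefD coefC coefCM coefX.
    case: j => [|[|j]] /=.
    - by rewrite addn0 binn mulr0 addr0.
    - by rewrite addn1 prednK // Fk -{1}(prednK k0) binSn prednK // add0r mulr1.
    by rewrite nth_default ?mul0rn ?mulr0 ?addr0 // sF; lia.
  rewrite !hornerE /c mulrN -scalerAr mulr_natl -scaler_nat scalerA.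
  by rewrite mulVf // scale1r subrr.
have FF1 : F = F1 \Po ('X - c%:P).
  rewrite /F1 -comp_polyA comp_polyD comp_polyX comp_polyC subrK.
  by rewrite comp_polyXr.
suff [e [s [e0 ss Hs]]] : exists e (s : seq {poly C}), [/\ (0 < e)%N, size s = k &
    cong (e * n) (ram e F1) (\prod_(p <- s) ('X - p%:P))].
  exists e, [seq p + (c \Po 'X^e) | p <- s]; split; rewrite ?size_map //.
  have -> : ram e F = ram e F1 \Po ('X - (c \Po 'X^e)%:P).
    by rewrite FF1 map_comp_poly rmorphB /= map_polyX map_polyC.
  have := cong_comp ('X - (c \Po 'X^e)%:P) Hs.
  rewrite rmorph_prod big_map /=; congr cong; apply: eq_bigr => p _.
  rewrite comp_polyB comp_polyX comp_polyC polyCD; ring.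
have [F1X|F1X] := eqVneq F1 'X^k.
  exists 1%N, (nseq k 0); split; rewrite ?size_nseq //.
  have -> : \prod_(p <- nseq k (0 : {poly C})) ('X - p%:P) = 'X^k.
    by elim: (k) => [|m IHm]; rewrite ?big_nil // big_cons IHm subr0 exprS.
  by rewrite F1X rmorphXn /= map_polyX; apply: cong_refl.
(* n is multiplied by L because t^L is the variable of F. *)
have [L [p [G [L0 mG sG HG Hj]]]] := blow_up mF1 sF1 F1k1 F1X.
have sj0 : (k.-1 <= k)%N by exact: leq_pred.
have Gk1 : (fiber 0 G)`_k.-1 = 0.
  have := HG _ sj0; rewrite coef_map F1k1 /= comp_poly0 => /eqP.
  rewrite eq_sym mulf_eq0 expf_eq0 polyX_eq0 andbF orFb => /eqP G0.
  by rewrite coef_fiber G0 horner0.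
have [mf sf] := fiber_monic 0 mG; rewrite sG in sf.
have [|g [h [mg mh cgh Ef [sg sh]]]] := split_fiber mf sf Gk1.
  by have [j jk Gj] := Hj; exists j => //; rewrite coef_fiber.
have [G1 [G2 [mG1 mG2 sG1 sG2 cG]]] := hensel (L * n) mG Ef mg mh cgh.
have g0 : (0 < size g)%N by rewrite size_poly_gt0 monic_neq0.
have h0 : (0 < size h)%N by rewrite size_poly_gt0 monic_neq0.
have lg : ((size g).-1 < k)%N by rewrite prednK.
have lh : ((size h).-1 < k)%N by rewrite prednK.
have eg : size G1 = (size g).-1.+1 by rewrite prednK.
have eh : size G2 = (size h).-1.+1 by rewrite prednK.
have [e1 [s1 [e10 ss1 H1]]] := IH _ lg G1 mG1 eg (L * n)%N.
have [e2 [s2 [e20 ss2 H2]]] := IH _ lh G2 mG2 eh (L * n)%N.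
pose e := (e1 * e2)%N.
pose s := [seq p \Po 'X^e2 | p <- s1] ++ [seq p \Po 'X^e1 | p <- s2].
have ss : size s = k.
  rewrite size_cat !size_map ss1 ss2.
  have := sf; rewrite Ef size_Mmonic ?monic_neq0 //.
  have aux (a b : nat) : (0 < a -> 0 < b -> (a + b).-1 = k.+1 -> a.-1 + b.-1 = k)%N.
    by lia.
  exact: aux.
have cGe : cong (e * (L * n)) (ram e G) (\prod_(p <- s) ('X - p%:P)).
  apply: (cong_trans (cong_ram e cG)); rewrite rmorphM big_cat -!ram_prod.
  apply: cong_mul.
    have := cong_ram e2 H1; rewrite ram_ram /e mulnA [(e2 * e1)%N]mulnC; exact.
  have := cong_ram e1 H2; rewrite ram_ram /e mulnA [(e2 * e1)%N]mulnC; exact.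
exists (L * e)%N, [seq 'X^(e * p) * q | q <- s]; split; rewrite ?size_map ?muln_gt0 ?L0 ?e10 //.
apply/congP => j; rewrite -ram_ram big_map.
case: (ltnP k j) => jk.
  exists 0; rewrite mulr0 addr0 nth_default.
    rewrite nth_default // -(big_map _ xpredT (fun q => 'X - q%:P)).
    by rewrite size_prod_XsubC size_map ss.
  by rewrite (leq_trans (size_poly _ _)) // (leq_trans (size_poly _ _)) // sF1.
have /congP /(_ j) [E HE] := cGe.
exists (('X^(e * p)) ^+ (k - j) * E).
rewrite coef_map HG //= comp_polyM comp_Xn_poly -exprM.
rewrite coef_prod_scale ss // -(coef_map (comp_poly 'X^e)) HE.
have -> : 'X^e ^+ (p * (k - j)) = 'X^(e * p * (k - j)) :> {poly C} by rewrite -exprM mulnA.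
have -> : (L * e * n = e * (L * n))%N by rewrite [(L * e)%N]mulnC mulnA.
rewrite -exprM; ring.
Qed.

End Puiseux.

(** * Characteristic polynomials along the fibers *)

Lemma rmorph_mmap n (S T U : comNzRingType) (f : {rmorphism S -> T})
    (psi : {rmorphism T -> U}) (h : 'I_n -> T) (t : {mpoly S[n]}) :
  psi (mmap f h t) = mmap (psi \o f) (psi \o h) t.
Proof.
rewrite /mmap rmorph_sum; apply: eq_bigr => m _.
rewrite rmorphM; congr (_ * _); rewrite /mmap1 rmorph_prod.
by apply: eq_bigr => i _; rewrite rmorphXn.
Qed.

Lemma mmap_mesym n (S T : comNzRingType) (f : {rmorphism S -> T})
    (h : 'I_n -> T) k :
  mmap f h (mesym n S k) = (mesym n T k).@[h].
Proof.
rewrite /mesym !rmorph_sum; apply: eq_bigr => A _.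
rewrite !rmorph_prod; apply: eq_bigr => i _.
by rewrite /= mmapX mmap1U mevalXU.
Qed.

Lemma mesym_polyC n (T : comNzRingType) (h : 'I_n -> T) k :
  (mesym n {poly T} k).@[fun i => (h i)%:P] = ((mesym n T k).@[h])%:P.
Proof.
pose c : {rmorphism T -> {poly T}} := polyC.
rewrite -(mmap_mesym (c \o idfun) (c \o h)) -[RHS]/(c (mmap idfun h _)).
by rewrite rmorph_mmap.
Qed.

Lemma eq_mmap n (S T : comNzRingType) (f f' : S -> T) (h h' : 'I_n -> T)
    (t : {mpoly S[n]}) : f =1 f' -> h =1 h' -> mmap f h t = mmap f' h' t.
Proof.
move=> ff hh; apply: eq_bigr => m _; rewrite ff; congr (_ * _).
exact: mmap1_eq.
Qed.

(** The polynomial prod_i (s - A(x,y_i)) is symmetric in the roots y_i of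
    F(x,.), hence a polynomial in their elementary symmetric functions, which
    are up to sign the coefficients of F. This yields a single B in K[x][s]
    that works for every x at once. *)
Lemma fiber_charpoly (K : idomainType) (F A : {poly {poly K}}) k :
  exists B : {poly {poly K}}, forall (x : K) (ys : seq K), size ys = k ->
    fiber x F = \prod_(y <- ys) ('X - y%:P) ->
    fiber x B = \prod_(y <- ys) ('X - ((fiber x A).[y])%:P).
Proof.
pose S : comNzRingType := {poly {poly K}}.
pose c : {rmorphism {poly K} -> {mpoly S[k]}} := @mpolyC k S \o polyC.
pose p : {mpoly S[k]} := \prod_(i < k) (('X)%:MP - (map_poly c A).['X_i]).
have psym : p \is symmetric.
  apply/issymP => s; rewrite rmorph_prod.
  rewrite [RHS](reindex_inj (@perm.perm_inj _ s)) /=.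
  have msC (a : S) : msym s a%:MP = a%:MP by rewrite /msym mmapC.
  apply: eq_bigr => i _; rewrite rmorphB /= msC -horner_map /=.
  rewrite -map_poly_comp /= [msym s 'X_i]mmapX mmap1U; congr (_ - (_ : {poly _}).[_]).
  by apply: eq_map_poly => a; rewrite /= msC.
have [t [tp _]] := sym_fundamental psym.
pose b (i : 'I_k) : S := ((-1) ^+ i.+1 * F`_(k - i.+1))%:P.
exists (t.@[b]) => x ys sy HF.
pose cs : k.-tuple K := tcast sy (in_tuple ys).
have csE : ys = cs :> seq K by rewrite val_tcast.
pose th : {rmorphism S -> {poly K}} := map_poly (horner_eval x).
pose h (i : 'I_k) := (tnth cs i)%:P.
have -> : fiber x (t.@[b]) = mmap th (th \o b) t.
  by rewrite -[LHS]/(th (mmap idfun b t)) rmorph_mmap.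
have -> : mmap th (th \o b) t = mmap th h p.
  rewrite -tp /comp_mpoly -[RHS]/((mmap th h) _) rmorph_mmap.
  apply: eq_mmap => [a|i] /=; first by rewrite mmapC.
  rewrite tnth_mktuple mmap_mesym mesym_polyC /b /th /= map_polyC /=.
  congr polyC; rewrite /horner_eval hornerM. rewrite -(coef_fiber x F) HF csE.
  have := mroots_coeff cs (lift ord0 i); rewrite lift0 => ->.
  rewrite -[((-1) ^+ _).[x]]/((horner_eval x) _) rmorphXn rmorphN1 mulrA.
  by rewrite -exprD -signr_odd oddD addbb mul1r.

rewrite /p rmorph_prod csE big_tuple; apply: eq_bigr => i _.
rewrite rmorphB /= mmapC; congr (_ - _); first exact: map_polyX.
have -> : ((fiber x A).[tnth cs i])%:P = (map_poly polyC (fiber x A)).[h i].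
  by rewrite horner_map.
rewrite -horner_map /= mmapX mmap1U -!map_poly_comp; congr (_.[_]).
by apply: eq_map_poly => a; rewrite /= mmapC /= map_polyC.
Qed.

(** * Estimates for polynomials in one variable *)

(** The real-valued modulus: inequalities between moduli live in an ordered
    field, in contrast with the partially ordered C. *)
Notation nm := (@Normc.normc _).
Notation ev P x y := ((map_poly (horner_eval x) P).[y]).

(** The Euler operator t d/dt preserves divisibility by t^v. *)
Lemma derivX_factor (K : comNzRingType) v (q : {poly K}) :
  'X * ('X^v * q)^`() = 'X^v * (v%:R *: q + 'X * q^`()).
Proof.
have XX : 'X * 'X^v^`() = v%:R *: 'X^v :> {poly K}.
  rewrite derivXn scaler_nat; case: v => [|v]; first by rewrite !mulr0n mulr0.
  by rewrite /= mulrnAr -exprS.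
rewrite derivM mulrDr mulrA XX mulrDr -scalerAl -scalerAr; congr (_ + _).
by rewrite !mulrA [X in X * _ = _]mulrC.
Qed.

Section Estimates.
Variable R : rcfType.
Notation C := (R[i]).
Implicit Types (x y z t w : C) (p q : {poly C}) (P A F : {poly {poly C}}).

Lemma nmC x : (nm x)%:C%C = `|x|.
Proof. by case: x => a b; rewrite normc_def. Qed.

Lemma nm_ge0 x : 0 <= nm x.
Proof. by rewrite -(@lecR R) nmC normr_ge0. Qed.

Lemma nm0 : nm (0 : C) = 0. Proof. exact: Normc.normc0. Qed.
Lemma nm1 : nm (1 : C) = 1. Proof. exact: Normc.normc1. Qed.
Lemma nmM x y : nm (x * y) = nm x * nm y. Proof. exact: Normc.normcM. Qed.

Lemma nm_eq0 x : (nm x == 0) = (x == 0).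
Proof. by apply/eqP/eqP => [/Normc.eq0_normc|->] //; exact: nm0. Qed.

Lemma nmN x : nm (- x) = nm x.
Proof. by apply: (@complexI R); rewrite !nmC normrN. Qed.

Lemma nmD x y : nm (x + y) <= nm x + nm y.
Proof. by rewrite -(@lecR R) rmorphD /= !nmC ler_normD. Qed.

Lemma nmB x y : nm (x - y) <= nm x + nm y.
Proof. by rewrite -(nmN y) nmD. Qed.

Lemma nmBC x y : nm (x - y) = nm (y - x).
Proof. by rewrite -nmN opprB. Qed.

Lemma nm_ler_sub x y : nm x <= nm y + nm (x - y).
Proof. by have := nmD y (x - y); rewrite subrKC. Qed.

Lemma nmX x n : nm (x ^+ n) = nm x ^+ n.
Proof. by elim: n => [|n IH]; rewrite ?expr0 ?nm1 // !exprS nmM IH. Qed.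

Lemma nm_nat n : nm (n%:R : C) = n%:R.
Proof. by apply: (@complexI R); rewrite nmC normr_nat rmorph_nat. Qed.

Lemma nm_sum (I : Type) (s : seq I) (G : I -> C) :
  nm (\sum_(i <- s) G i) <= \sum_(i <- s) nm (G i).
Proof.
elim: s => [|i s IH]; first by rewrite !big_nil nm0.
rewrite !big_cons; have := nmD (G i) (\sum_(j <- s) G j); lra.
Qed.

Lemma nm_prod (I : Type) (s : seq I) (G : I -> C) :
  nm (\prod_(i <- s) G i) = \prod_(i <- s) nm (G i).
Proof.
elim: s => [|i s IH]; first by rewrite !big_nil nm1.
by rewrite !big_cons nmM IH.
Qed.

Lemma ev_MXaddC P p x y : ev (P * 'X + p%:P) x y = ev P x y * y + p.[x].
Proof.
by rewrite rmorphD rmorphM /= map_polyX map_polyC /= !hornerE.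
Qed.

Lemma poly_bounded p : exists c : R, 1 <= c /\ forall t, nm t <= 1 -> nm p.[t] <= c.
Proof.
elim/poly_ind: p => [|p a [c [c1 H]]].
  by exists 1; split=> // t _; rewrite horner0 nm0 ler01.
exists (c + nm a); split; first by have := nm_ge0 a; lra.
move=> t t1; rewrite hornerMXaddC; have := nmD (p.[t] * t) a; rewrite nmM.
have := H t t1; have := nm_ge0 t; have := nm_ge0 p.[t]; nra.
Qed.

Lemma ev_bounded P (B : R) : 1 <= B -> exists c : R, 1 <= c /\
  forall x y, nm x <= 1 -> nm y <= B -> nm (ev P x y) <= c.
Proof.
move=> B1; elim/poly_ind: P => [|P p [c [c1 H]]].
  by exists 1; split=> // x y _ _; rewrite rmorph0 horner0 nm0 ler01.
have [c' [c'1 H']] := poly_bounded p.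
exists (c * B + c'); split; first by nra.
move=> x y x1 yB; rewrite ev_MXaddC; have := nmD (ev P x y * y) p.[x].
rewrite nmM; have := H x y x1 yB; have := H' x x1; have := nm_ge0 y.
have := nm_ge0 (ev P x y); nra.
Qed.

Lemma ev_lipschitz P (B : R) : 1 <= B -> exists c : R, 1 <= c /\
  forall x y y', nm x <= 1 -> nm y <= B -> nm y' <= B ->
    nm (ev P x y - ev P x y') <= c * nm (y - y').
Proof.
move=> B1; elim/poly_ind: P => [|P p [c [c1 H]]].
  exists 1; split=> // x y y' _ _ _.
  by rewrite rmorph0 !horner0 subrr nm0 mul1r nm_ge0.
have [c' [c'1 H']] := ev_bounded P B1.
exists (c * B + c'); split; first by nra.
move=> x y y' x1 yB y'B; rewrite !ev_MXaddC.
have -> : ev P x y * y + p.[x] - (ev P x y' * y' + p.[x]) =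
  (ev P x y - ev P x y') * y + ev P x y' * (y - y') by ring.
have := nmD ((ev P x y - ev P x y') * y) (ev P x y' * (y - y')).
rewrite !nmM; have := H x y y' x1 yB y'B; have := H' x y' x1 y'B.
have := nm_ge0 y; have := nm_ge0 (y - y').
have := nm_ge0 (ev P x y - ev P x y').
nra.
Qed.

(** A polynomial with nonzero constant term a stays above |a|/2 near 0. *)
Lemma poly_unit_bound p : p.[0] != 0 ->
  exists c : R, 1 <= c /\ forall t, c * nm t <= 1 -> 1 <= c * nm p.[t].
Proof.
move=> p0; elim/poly_ind: p p0 => [|p a _]; first by rewrite horner0 eqxx.
rewrite hornerMXaddC mulr0 add0r -nm_eq0 => a0.
have [b [b1 Hb]] := poly_bounded p.
have an := nm_ge0 a; have {}a0 : 0 < nm a by rewrite lt_def a0.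
have ai : 0 < (nm a)^-1 by rewrite invr_gt0.
exists (2 * b * (1 + (nm a)^-1)); split; first by nra.
move=> t; rewrite mulrDr mulr1 !mulrDl => Ht.
have t1 : nm t <= 1.
  have := nm_ge0 t; have : 0 <= 2 * b * (nm a)^-1 * nm t by rewrite !mulr_ge0 ?nm_ge0 //; lra.
  nra.
have Hbt := Hb t t1.
have bt : b * nm t <= nm a / 2.
  have := nm_ge0 t => t0.
  have : 2 * b * (nm a)^-1 * nm t <= 1 by nra.
  have E : nm a * (nm a)^-1 = 1 by rewrite divff // gt_eqF.
  move=> /(ler_wpM2l an); have -> : nm a * (2 * b * (nm a)^-1 * nm t) = 2 * b * nm t * (nm a * (nm a)^-1) by ring.
  rewrite E; lra.
have pt : nm a / 2 <= nm (p * 'X + a%:P).[t].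
  rewrite hornerMXaddC.
  have := nm_ler_sub a (p.[t] * t + a).
  have -> : a - (p.[t] * t + a) = - (p.[t] * t) by ring.
  rewrite nmN nmM; have := nm_ge0 t; have := nm_ge0 p.[t]; nra.
have E : nm a * (nm a)^-1 = 1 by rewrite divff // gt_eqF.
have nn := nm_ge0 (p * 'X + a%:P).[t].
have := ler_wpM2r (ltW ai) pt; rewrite mulrAC E => H1.
have : 1 <= 2 * (nm (p * 'X + a%:P).[t] / nm a) by lra.
set N := nm _ => H2; have : 0 <= N * (nm a)^-1 by rewrite mulr_ge0 // ltW.
have : 0 <= 2 * b * N by rewrite !mulr_ge0 //; lra.
nra.
Qed.

Lemma ler_absorb (b u c N : R) : u <= b -> 0 <= b -> 1 <= c * N -> u <= c * b * N.
Proof.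
move=> ub b0 cN; apply: le_trans ub _; rewrite mulrAC -[leLHS]mul1r.
by rewrite ler_wpM2r.
Qed.

Lemma mul_ge1 (a b : R) : 1 <= a -> 1 <= b -> 1 <= a * b.
Proof. by move=> a1 b1; rewrite mulr_ege1. Qed.

Lemma mul_ge1l (a b : R) : 1 <= a -> 1 <= b -> a <= a * b.
Proof. by move=> a1 b1; rewrite ler_peMr //; lra. Qed.

Lemma cnm_le1 (c : R) t : 1 <= c -> c * nm t <= 1 -> nm t <= 1.
Proof.
move=> c1; apply: le_trans; rewrite -[leLHS]mul1r.
by rewrite ler_wpM2r // nm_ge0.
Qed.

Lemma cnm_mono (c c' : R) t : c <= c' -> c' * nm t <= 1 -> c * nm t <= 1.
Proof.
by move=> cc; apply: le_trans; rewrite ler_wpM2r // nm_ge0.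
Qed.

(** Writing p = t^v q with q(0) <> 0, both sides have the factor t^v, and q is
    bounded below near 0. *)
Lemma derivX_le p : exists c : R, 1 <= c /\
  forall t, c * nm t <= 1 -> nm (t * p^`().[t]) <= c * nm p.[t].
Proof.
have [->|p0] := eqVneq p 0.
  by exists 1; split=> // t _; rewrite deriv0 !horner0 mulr0 nm0 mulr0.
have [v [q [-> q0]]] := poly_Xn_factor p0.
have [c [c1 Hc]] := poly_unit_bound q0.
have [b [b1 Hb]] := poly_bounded (v%:R *: q + 'X * q^`()).
exists (c * b); split; first exact: mul_ge1.
move=> t Ht; have ct : c * nm t <= 1 by apply: cnm_mono Ht; apply: mul_ge1l.
have := Hc t ct; have := Hb t (cnm_le1 c1 ct).
have -> : t * ('X^v * q)^`().[t] = ('X * ('X^v * q)^`()).[t] by rewrite hornerM hornerX.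
rewrite derivX_factor !(hornerM, hornerXn) !nmM nmX.
set w := (_ + _ * _).[t]; move=> h1 h2.
have tv : 0 <= nm t ^+ v by rewrite exprn_ge0 ?nm_ge0.
have : nm w <= c * b * nm q.[t] by apply: ler_absorb h1 _ h2; lra.
by move/(ler_wpM2l tv); rewrite mulrCA.
Qed.

(** With p = t^v q and v > 0, the cofactor v q + t q' of t^v in t p' takes the
    nonzero value v q(0) at 0. In orders: passing to t p' does not raise the
    order of vanishing of p. *)
Lemma derivX_ge p : p.[0] = 0 -> exists c : R, 1 <= c /\
  forall t, c * nm t <= 1 -> nm p.[t] <= c * nm (t * p^`().[t]).
Proof.
move=> pz; have [->|p0] := eqVneq p 0.
  by exists 1; split=> // t _; rewrite deriv0 !horner0 mulr0 nm0 mulr0.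
have [v [q [E q0]]] := poly_Xn_factor p0.
have v0 : v != 0%N.
  by apply: contraNneq q0 => v0; have := pz; rewrite E v0 expr0 mul1r => ->.
rewrite E {E p0 pz}.
have w0 : (v%:R *: q + 'X * q^`()).[0] != 0.
  by rewrite hornerD hornerZ hornerM hornerX mul0r addr0 mulf_neq0 ?pnatr_eq0.
have [c [c1 Hc]] := poly_unit_bound w0.
have [b [b1 Hb]] := poly_bounded q.
exists (c * b); split; first exact: mul_ge1.
move=> t Ht; have ct : c * nm t <= 1 by apply: cnm_mono Ht; apply: mul_ge1l.
have := Hc t ct; have := Hb t (cnm_le1 c1 ct).
have -> : t * ('X^v * q)^`().[t] = ('X * ('X^v * q)^`()).[t] by rewrite hornerM hornerX.
rewrite derivX_factor !(hornerM, hornerXn) !nmM nmX.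
set w := (_ + _ * _).[t]; move=> h1 h2.
have tv : 0 <= nm t ^+ v by rewrite exprn_ge0 ?nm_ge0.
have : nm q.[t] <= c * b * nm w by apply: ler_absorb h1 _ h2; lra.
by move/(ler_wpM2l tv); rewrite mulrCA.
Qed.

(** A polynomial of degree at most n vanishes to order at most n at 0. *)
Lemma poly_lower_bound p n : p != 0 -> (size p <= n.+1)%N ->
  exists c : R, 1 <= c /\ forall t, c * nm t <= 1 -> nm t ^+ n <= c * nm p.[t].
Proof.
move=> p0; have [v [q [-> q0]]] := poly_Xn_factor p0 => sn.
have q00 : q != 0 by apply: contraNneq q0 => ->; rewrite horner0.
have vn : (v <= n)%N.
  move: sn; rewrite mulrC size_mulXn // => sn.
  have aux (a b : nat) : (a + b <= n.+1 -> 0 < b -> a <= n)%N by lia.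
  by apply: aux sn _; rewrite size_poly_gt0.
have [c [c1 Hc]] := poly_unit_bound q0.
exists c; split=> // t ct; rewrite hornerM hornerXn nmM nmX.
have t1 := cnm_le1 c1 ct; have tv : 0 <= nm t ^+ v by rewrite exprn_ge0 ?nm_ge0.
have := ler_wiXn2l (nm_ge0 t) t1 vn.
have := ler_wpM2l tv (Hc t ct); rewrite mulr1 mulrCA => h1 h2.
exact: le_trans h2 h1.
Qed.

Lemma horner_nm_le p x :
  nm p.[x] <= \sum_(i < size p) nm p`_i * nm x ^+ i.
Proof.
rewrite horner_coef (le_trans (nm_sum _ _)) // ler_sum // => i _.
by rewrite nmM nmX.
Qed.

(** Otherwise the leading term would dominate at infinity. This replaces the
    bookkeeping of degrees in resultants. *)
Lemma size_growth p n (c : R) : 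
  (forall x, 1 <= nm x -> nm p.[x] <= c * nm x ^+ n) -> (size p <= n.+1)%N.
Proof.
move=> H; rewrite leqNgt; apply/negP => sp.
pose s := (size p).-1; have ss : size p = s.+1 by rewrite /s (ltn_predK sp).
have ns : (n < s)%N by rewrite -ltnS -ss.
pose a := nm p`_s.
have a0 : 0 < a.
  rewrite lt_def nm_ge0 nm_eq0 /s -lead_coefE lead_coef_eq0 andbT.
  by rewrite -size_poly_eq0 ss.
pose S := \sum_(i < s) nm p`_i.
have S0 : 0 <= S by rewrite sumr_ge0 // => i _; rewrite nm_ge0.
have key x : 1 <= nm x -> a * nm x <= c + S.
  move=> x1; have x0 : 0 < nm x by lra.
  have xs : 0 < nm x ^+ s.-1 by rewrite exprn_gt0.
  rewrite -(ler_pM2r xs) -mulrA -exprS prednK ?(leq_ltn_trans _ ns) // mulrDl.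
  have := horner_coef p x; rewrite ss big_ord_recr /= => E.
  have : nm (p`_s * x ^+ s) <= nm p.[x] + nm (\sum_(i < s) p`_i * x ^+ i).
    have -> : p`_s * x ^+ s = p.[x] - \sum_(i < s) p`_i * x ^+ i by rewrite E; ring.
    exact: nmB.
  rewrite nmM nmX -/a => h1.
  have h2 : nm p.[x] <= c * nm x ^+ s.-1.
    have c0 : 0 <= c.
      have xn : 0 < nm x ^+ n by rewrite exprn_gt0.
      by rewrite -(pmulr_lge0 _ xn); apply: le_trans (H x x1); rewrite nm_ge0.
    apply: le_trans (H x x1) _; rewrite ler_wpM2l // ler_weXn2l //.
    by rewrite -ltnS prednK // (leq_ltn_trans _ ns).
  have h3 : nm (\sum_(i < s) p`_i * x ^+ i) <= S * nm x ^+ s.-1.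
    apply: le_trans (nm_sum _ _) _; rewrite mulr_suml ler_sum // => i _.
    rewrite nmM nmX ler_wpM2l ?nm_ge0 // ler_weXn2l //.
    by rewrite -ltnS prednK // (leq_ltn_trans _ ns).
  lra.
have cS : 0 <= c + S by have := key 1; rewrite nm1 => /(_ (lexx _)); lra.
pose r := (c + S) / a + 1.
have r1 : 1 <= r by rewrite /r; have : 0 <= (c + S) / a; [rewrite divr_ge0 // ltW|lra].
have nr : nm (r%:C)%C = r.
  by apply: (@complexI R); rewrite nmC normc_def /= expr0n addr0 sqrtr_sqr ger0_norm //; lra.
have := key (r%:C)%C; rewrite nr => /(_ r1).
have -> : a * r = c + S + a by rewrite /r mulrDr mulr1 mulrC divfK // gt_eqF.
lra.
Qed.

End Estimates.

(** * Majorants and growth of the roots *)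

Section RootsOverTheLine.
Variable R : rcfType.
Notation C := (R[i]).
Implicit Types (x y z t w : C) (p q : {poly C}) (P A F : {poly {poly C}}).

(** Bounding the coefficients together with the value makes the bound
    submultiplicative, hence computable on products of linear factors. *)
Definition maj p (r : R) : R := \sum_(i < size p) nm p`_i * r ^+ i.

Lemma maj_wide n p r : (size p <= n)%N -> maj p r = \sum_(i < n) nm p`_i * r ^+ i.
Proof.
move=> pn; rewrite /maj (big_ord_widen n (fun i => nm p`_i * r ^+ i)) //.
rewrite big_mkcond; apply: eq_bigr => i _; case: ltnP => // pi.
by rewrite nth_default // nm0 mul0r.
Qed.

Lemma maj_ge0 p r : 0 <= r -> 0 <= maj p r.
Proof. by move=> r0; rewrite sumr_ge0 // => i _; rewrite mulr_ge0 ?nm_ge0 ?exprn_ge0. Qed.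

Lemma nm_horner_maj p x : nm p.[x] <= maj p (nm x).
Proof. exact: horner_nm_le. Qed.

Lemma maj_mulXsub w q r : 0 <= r -> maj (('X - w%:P) * q) r <= (r + nm w) * maj q r.
Proof.
move=> r0; pose n := size q.
have s1 : (size (('X - w%:P) * q)%R <= n.+1)%N.
  by rewrite (leq_trans (size_polyMleq _ _)) // size_XsubC.
rewrite (maj_wide _ s1) [leRHS]mulrDl.
have -> : r * maj q r = \sum_(i < n.+1) nm ('X * q)`_i * r ^+ i.
  rewrite big_ord_recl coefXM eqxx nm0 mul0r add0r mulr_sumr; apply: eq_bigr => i _.
  by rewrite lift0 coefXM /= exprS; ring.
have -> : nm w * maj q r = \sum_(i < n.+1) nm (w * q`_i) * r ^+ i.
  rewrite (maj_wide r (leqnSn n)) mulr_sumr; apply: eq_bigr => i _.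
  by rewrite nmM mulrA.
rewrite -big_split /= ler_sum // => i _; rewrite -mulrDl ler_wpM2r ?exprn_ge0 //.
by rewrite mulrBl coefB coefCM nmB.
Qed.

Lemma maj_prod (s : seq C) r : 0 <= r ->
  maj (\prod_(w <- s) ('X - w%:P)) r <= \prod_(w <- s) (r + nm w).
Proof.
move=> r0; elim: s => [|w s IH].
  by rewrite !big_nil /maj size_poly1 big_ord1 coef1 /= nm1 mul1r.
rewrite !big_cons (le_trans (maj_mulXsub _ _ r0)) // ler_wpM2l //.
by rewrite addr_ge0 ?nm_ge0.
Qed.

Lemma nm_coef_maj p k : nm p`_k <= maj p 1.
Proof.
case: (ltnP k (size p)) => kp; last by rewrite nth_default // nm0 maj_ge0.
rewrite /maj (bigD1 (Ordinal kp)) //= expr1n mulr1 lerDl sumr_ge0 // => i _.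
by rewrite expr1n mulr1 nm_ge0.
Qed.

(** The coefficients of p are at most those of its derivative, shifted. *)
Lemma maj_deriv p r : 0 <= r -> maj (p - (p`_0)%:P) r <= r * maj p^`() r.
Proof.
move=> r0; pose n := size p.
have s1 : (size (p - (p`_0)%:P)%R <= n.+1)%N.
  rewrite (leq_trans (size_polyD _ _)) // size_polyN geq_max leqnSn.
  by rewrite (leq_trans (size_polyC_leq1 _)).
have s2 : (size p^`() <= n)%N by rewrite (leq_trans (size_poly _ _)) ?leq_pred.
rewrite (maj_wide _ s1) (maj_wide _ s2) big_ord_recl coefB coefC subrr nm0 mul0r add0r.
rewrite mulr_sumr ler_sum // => i _; rewrite lift0 coefB coefC subr0 coef_deriv.
rewrite exprS mulrCA ler_wpM2l // ler_wpM2r ?exprn_ge0 //.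
rewrite -mulr_natr nmM nm_nat ler_peMr ?nm_ge0 //.
by rewrite (ler_nat _ 1).
Qed.

Lemma maj_scale a p r : maj (a%:P * p) r = nm a * maj p r.
Proof.
have s1 : (size (a%:P * p)%R <= size p)%N by rewrite mul_polyC size_scale_leq.
rewrite (maj_wide _ s1) mulr_sumr; apply: eq_bigr => i _.
by rewrite coefCM nmM mulrA.
Qed.

(** The total degree is at most n. *)
Definition degle (n : nat) P := forall j, (size (P`_j)%R <= n.+1 - j)%N.

Lemma poly_growth p s : (size p <= s.+1)%N -> exists c : R, 0 <= c /\
  forall (X : R) x, 1 <= X -> nm x <= X -> nm p.[x] <= c * X ^+ s.
Proof.
move=> ps; exists (maj p 1); split; first exact: maj_ge0.
move=> X x X1 xX; apply: le_trans (nm_horner_maj _ _) _.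
rewrite /maj mulr_suml ler_sum // => i _; rewrite expr1n mulr1 ler_wpM2l ?nm_ge0 //.
apply: (@le_trans _ _ (X ^+ i)).
  by rewrite lerXn2r // ?nnegrE ?nm_ge0 //; lra.
by rewrite ler_weXn2l //; have := ltn_ord i; lia.
Qed.

Lemma degle_growth P n : degle n P -> exists c : R, 0 <= c /\
  forall j (X : R) x, (j <= n)%N -> 1 <= X -> nm x <= X -> nm (P`_j).[x] <= c * X ^+ (n - j).
Proof.
move=> Pn.
have H j : exists c : R, 0 <= c /\ forall (X : R) x, (j <= n)%N -> 1 <= X -> nm x <= X ->
    nm (P`_j).[x] <= c * X ^+ (n - j).
  case: (leqP j n) => jn; last by exists 0; split=> // *; lia.
  have := Pn j; rewrite subSn // => /poly_growth [c [c0 Hc]].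
  by exists c; split=> // X x _; apply: Hc.
suff [c [c0 Hc]] : exists c : R, 0 <= c /\
  forall j (X : R) x, (j < n.+1)%N -> (j <= n)%N -> 1 <= X -> nm x <= X -> nm (P`_j).[x] <= c * X ^+ (n - j).
  by exists c; split=> // j X x jn; apply: Hc.
elim: {1}n.+1 => [|m [c [c0 IH]]]; first by exists 0; split.
have [c' [c'0 Hc']] := H m; exists (c + c'); split; first by rewrite addr_ge0.
move=> j X x; rewrite ltnS leq_eqVlt => /orP [/eqP ->|jm] jn X1 xX.
  apply: le_trans (Hc' X x jn X1 xX) _; rewrite ler_wpM2r ?exprn_ge0 //; lra.
apply: le_trans (IH j X x jm jn X1 xX) _; rewrite ler_wpM2r ?exprn_ge0 //; lra.
Qed.

Lemma degle_size P n : degle n P -> (size P <= n.+1)%N.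
Proof.
by move=> H; apply/leq_sizeP => j nj; apply/eqP; rewrite -size_poly_eq0 -leqn0 -(eqP nj).
Qed.

Lemma ev_sum P n x y : (size P <= n)%N -> ev P x y = \sum_(j < n) (P`_j).[x] * y ^+ j.
Proof.
move=> Pn; rewrite (@horner_coef_wide _ n) ?(leq_trans (size_poly _ _)) //.
by apply: eq_bigr => j _; rewrite coef_map.
Qed.

Lemma ev_growth P n (B : R) : 1 <= B -> degle n P -> exists c : R, 1 <= c /\
  forall (X : R) x y, 1 <= X -> nm x <= X -> nm y <= B * X -> nm (ev P x y) <= c * X ^+ n.
Proof.
move=> B1 Pn; have [c [c0 Hc]] := degle_growth Pn.
have B0 : 0 <= B by lra.
exists (1 + \sum_(j < n.+1) c * B ^+ j); split.
  by rewrite lerDl sumr_ge0 // => j _; rewrite mulr_ge0 ?exprn_ge0.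
move=> X x y X1 xX yX; have X0 : 0 <= X by lra.
rewrite (ev_sum _ _ (degle_size Pn)) (le_trans (nm_sum _ _)) // mulrDl.
rewrite ler_wpDl ?mul1r ?exprn_ge0 // mulr_suml ler_sum // => j _.
have jn : (j <= n)%N by rewrite -ltnS ltn_ord.
rewrite nmM nmX; have -> : X ^+ n = X ^+ (n - j) * X ^+ j by rewrite -exprD subnK.
have -> : c * B ^+ j * (X ^+ (n - j) * X ^+ j) = (c * X ^+ (n - j)) * (B * X) ^+ j.
  by rewrite exprMn; ring.
rewrite ler_pM ?nm_ge0 ?exprn_ge0 ?nm_ge0 ?Hc // lerXn2r ?nnegrE ?nm_ge0 //.
by rewrite mulr_ge0.
Qed.

(** If |y| exceeds X then every lower term of F(x,y) is at most c X |y|^(K-1),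
    while the leading term is |y|^K. *)
Lemma root_bound F K : F \is monic -> size F = K.+1 -> degle K F ->
  exists B : R, 1 <= B /\
  forall (X : R) x y, 1 <= X -> nm x <= X -> ev F x y = 0 -> nm y <= B * X.
Proof.
move=> mF sF dF; have [c [c0 Hc]] := degle_growth dF.
exists (1 + c *+ K); split; first by rewrite lerDl mulrn_wge0.
move=> X x y X1 xX; have X0 : 0 <= X by lra.
rewrite (@ev_sum F K.+1) ?sF // big_ord_recr /=.
have -> : F`_K = 1 by have /monicP := mF; rewrite lead_coefE sF.
rewrite hornerC mul1r => E.
have cK : 0 <= c *+ K * X by rewrite mulr_ge0 // mulrn_wge0.
rewrite mulrDl mul1r; case: (lerP (nm y) X) => yX; first by lra.
have y0 : 0 < nm y by apply: le_lt_trans yX.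
case: K sF dF Hc E cK => [|K] sF dF Hc E cK.
  by move: E; rewrite big_ord0 add0r expr0 => /eqP; rewrite oner_eq0.
have E' : y ^+ K.+1 = - \sum_(j < K.+1) (F`_j).[x] * y ^+ j.
  by apply/eqP; rewrite -addr_eq0 addrC E.
have : nm y ^+ K.+1 <= c *+ K.+1 * X * nm y ^+ K.
  have -> : c *+ K.+1 * X * nm y ^+ K = \sum_(j < K.+1) c * (X * nm y ^+ K).
    by rewrite sumr_const card_ord -!mulrnAl mulrA.
  rewrite -nmX E' nmN (le_trans (nm_sum _ _)) // ler_sum // => j _.
  have jK : (j <= K)%N by rewrite -ltnS ltn_ord.
  rewrite nmM nmX; apply: (@le_trans _ _ (c * X ^+ (K.+1 - j) * nm y ^+ j)).
    by rewrite ler_wpM2r ?exprn_ge0 ?nm_ge0 // Hc // leqW.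
  rewrite -mulrA ler_wpM2l // subSn // exprS -mulrA ler_wpM2l //.
  have -> : nm y ^+ K = nm y ^+ (K - j) * nm y ^+ j by rewrite -exprD subnK.
  rewrite ler_wpM2r ?exprn_ge0 ?nm_ge0 // lerXn2r ?nnegrE ?nm_ge0 //.
  exact: ltW.
rewrite exprS ler_pM2r ?exprn_gt0 // => h; lra.
Qed.

Lemma fiber_roots F K x : F \is monic -> size F = K.+1 ->
  exists ys, size ys = K /\ fiber x F = \prod_(y <- ys) ('X - y%:P).
Proof.
move=> mF sF; have [mf sf] := fiber_monic x mF.
have [ys E] := closed_field_poly_normal (fiber x F).
exists ys; move: E; rewrite (monicP mf) scale1r => E; split=> //.
by have := size_prod_XsubC ys id; rewrite -E sf sF => -[].
Qed.

End RootsOverTheLine.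

(** * The gap property of values at the roots *)

Section Gap.
Variable R : rcfType.
Notation C := (R[i]).
Implicit Types (x y z t w : C) (p q : {poly C}) (P A F : {poly {poly C}}).

Lemma prod_le_exp (s : seq C) (f : C -> R) (M : R) :
  (forall y, y \in s -> 0 <= f y <= M) -> \prod_(y <- s) f y <= M ^+ size s.
Proof.
elim: s => [|y s IH] H; first by rewrite big_nil.
rewrite big_cons exprS; have /andP [f0 fM] := H y (mem_head _ _).
have Hs z : z \in s -> 0 <= f z <= M by move=> zs; apply: H; rewrite in_cons zs orbT.
apply: ler_pM => //; last exact: IH.
by rewrite big_seq prodr_ge0 // => z /Hs /andP [].
Qed.

(** A quantitative form of Bezout's theorem. Let B(x,s) be the characteristic
    polynomial of A on the roots of F(x,.), and b(x) s^v its lowest nonzero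
    term. The growth of roots bounds the degree of b by n K. If g is a nonzero
    value of A at a root then B(x,g) = 0 forces |b(x)| <= c |g|, and
    |b(x)| >= c |x|^(n K) near 0. *)
Lemma root_gap F A K n : F \is monic -> size F = K.+1 -> degle K F -> degle n A ->
  exists c : R, 1 <= c /\ forall x y, c * nm x <= 1 -> ev F x y = 0 ->
    ev A x y = 0 \/ nm x ^+ (n * K) <= c * nm (ev A x y).
Proof.
move=> mF sF dF dA.
have [B [B1 HB]] := root_bound mF sF dF.
have [a [a1 Ha]] := ev_growth B1 dA.
have [Z HZ] := fiber_charpoly F A K.
have Zroot x y : ev F x y = 0 -> (fiber x Z).[ev A x y] = 0.
  have [ys [sy Ey]] := fiber_roots x mF sF; rewrite (HZ x ys sy Ey) Ey.
  rewrite !horner_prod => /eqP; rewrite prodf_seq_eq0 => /hasP [y' y'ys].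
  rewrite /= !hornerE subr_eq0 => /eqP ->.
  by apply/eqP; rewrite prodf_seq_eq0; apply/hasP; exists y' => //; rewrite /= !hornerE subrr.
have Z0 : exists v, Z`_v != 0.
  have [ys [sy Ey]] := fiber_roots 0 mF sF.
  have mZ : fiber 0 Z \is monic by rewrite (HZ 0 ys sy Ey) monic_prod_XsubC.
  have : Z != 0 by apply: contraTneq mZ => ->; rewrite rmorph0 monicE lead_coef0 eq_sym oner_eq0.
  by rewrite -lead_coef_eq0 lead_coefE; exists (size Z).-1.
case: (ex_minnP Z0) => v Zv vmin; pose b := Z`_v.
have sb : (size b <= (n * K).+1)%N.
  apply: (@size_growth _ _ _ ((2 * a) ^+ K)) => x x1.
  have [ys [sy Ey]] := fiber_roots x mF sF.
  rewrite /b -coef_fiber (HZ x ys sy Ey) -(big_map (fun y => ev A x y) xpredT (fun g => 'X - g%:P)).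
  rewrite (le_trans (nm_coef_maj _ _)) // (le_trans (maj_prod _ ler01)) // big_map.
  rewrite exprM -exprMn -sy; apply: prod_le_exp => y yys.
  have Fy : ev F x y = 0 by apply/eqP; rewrite Ey -[_ == 0]/(root _ _) root_prod_XsubC.
  have := Ha _ x y x1 (lexx _) (HB _ x y x1 (lexx _) Fy).
  have := nm_ge0 (ev A x y); have : 1 <= nm x ^+ n by rewrite exprn_ege1.
  set g := nm _; set X := _ ^+ n => X1 g0 gX; rewrite addr_ge0 //=.
  have : X <= a * X by rewrite ler_peMl //; lra.
  lra.
have [c [c1 Hc]] := poly_lower_bound Zv sb.
(* Z = s^v (b + s Z2), so at a nonzero root g of Z, b = - g Z2(x, g). *)
pose Z2 := drop_poly v.+1 Z.
have EZ : Z = (Z2 * 'X + b%:P) * 'X^v.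
  apply/polyP => j; rewrite coefMXn; case: ltnP => jv.
    by apply/eqP; apply: contraTT jv => /vmin; rewrite -leqNgt.
  rewrite coefD coefMX coefC subn_eq0; case: (leqP j v) => vj; last first.
    by rewrite addr0 coef_drop_poly; congr (Z`_ _); lia.
  by rewrite add0r; congr (Z`_ _); lia.
have [M [M1 HM]] := ev_bounded Z2 a1.
exists (c * M); split; first exact: mul_ge1.
move=> x y Hx F0; have cx : c * nm x <= 1 by apply: cnm_mono Hx; apply: mul_ge1l.
have x1 := cnm_le1 c1 cx.
have [->|g0] := eqVneq (ev A x y) 0; [by left|right].
set g := ev A x y in g0 *.
have ga : nm g <= a.
  have := Ha 1 x y (lexx _) x1; rewrite !mulr1 expr1n mulr1; apply.
  by have := HB 1 x y (lexx _) x1 F0; rewrite mulr1.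
have := Zroot x y F0; rewrite -/g EZ rmorphM /= hornerM => /eqP.
rewrite map_polyXn hornerXn mulf_eq0 [g ^+ v == 0]expf_eq0 (negPf g0) andbF orbF.
rewrite -/(ev (Z2 * 'X + b%:P) x g) ev_MXaddC addrC addr_eq0 => /eqP bE.
apply: le_trans (Hc x cx) _; rewrite bE nmN nmM mulrA.
rewrite ler_wpM2r ?nm_ge0 // ler_wpM2l //; first by lra.
exact: HM.
Qed.

(** The majorant of P(x, w + .) - P(x, w): all Taylor terms of positive order,
    in absolute value, at distance r from w. *)
Definition taylor_maj P x w (r : R) : R :=
  maj ((fiber x P \Po ('X + w%:P)) - (ev P x w)%:P) r.

(** The y-derivative of P(x, w + .) is a multiple of the product of the
    ((y + w) - y_i), whose majorant is the product of the r + |y_i - w|. *)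
Lemma taylor_maj_le P x w (r : R) (a : C) (ys : seq C) : 0 <= r ->
  fiber x P^`() = a%:P * \prod_(y <- ys) ('X - y%:P) ->
  taylor_maj P x w r <= r * (nm a * \prod_(y <- ys) (r + nm (y - w))).
Proof.
move=> r0 HF; pose q := fiber x P \Po ('X + w%:P).
have q0 : ev P x w = q`_0 by rewrite coef_comp_polyXaddC nderivn0.
rewrite /taylor_maj q0 (le_trans (maj_deriv _ r0)) // ler_wpM2l //.
have -> : q^`() = a%:P * \prod_(y <- [seq y - w | y <- ys]) ('X - y%:P).
  rewrite deriv_comp derivD derivX derivC addr0 mulr1 deriv_map HF.
  rewrite comp_polyM comp_polyC; congr (_ * _).
  rewrite big_map rmorph_prod; apply: eq_bigr => y _ /=.
  rewrite comp_polyB comp_polyX comp_polyC polyCB; ring.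
rewrite maj_scale ler_wpM2l ?nm_ge0 // (le_trans (maj_prod _ r0)) //.
by rewrite big_map.
Qed.

Lemma ev_taylor_maj P x w rho : nm (ev P x (w + rho) - ev P x w) <= taylor_maj P x w (nm rho).
Proof.
apply: le_trans (nm_horner_maj _ _).
by rewrite hornerD hornerN hornerC horner_comp !hornerE [rho + w]addrC.
Qed.
End Gap.

(** * Differentiation along a branch *)

(** The partial derivative in x; the one in y is the derivative of the outer
    polynomial. *)
Notation dx := (map_poly (@deriv _)).

Section Dx.
Variable K : idomainType.
Implicit Types (P Q : {poly {poly K}}) (p : {poly K}).

Lemma dxM P Q : dx (P * Q) = dx P * Q + P * dx Q.
Proof.
apply/polyP => i; rewrite coefD coef_map !coefM raddf_sum -big_split /=.
by apply: eq_bigr => j _; rewrite !coef_map /= derivM.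
Qed.

Lemma dxC p : dx (p%:P) = (p^`())%:P.
Proof. exact: map_polyC. Qed.

Lemma dxX : dx ('X : {poly {poly K}}) = 0.
Proof.
apply/polyP => i; rewrite coef_map coefX coef0 /=.
by case: eqP => _; rewrite ?derivC // mulr0n deriv0.
Qed.

(** P(t^e, phi(t) + y): the polynomial P recentered along a branch. *)
Definition along (e : nat) (phi : {poly K}) P := ram e P \Po ('X + phi%:P).

Lemma alongMXaddC e phi P p :
  along e phi (P * 'X + p%:P) = along e phi P * ('X + phi%:P) + (p \Po 'X^e)%:P.
Proof.
by rewrite /along rmorphD rmorphM /= map_polyX map_polyC comp_polyD comp_polyM comp_polyX comp_polyC.
Qed.

Lemma fiber_along e phi P (t : K) :
  fiber t (along e phi P) = fiber (t ^+ e) P \Po ('X + (phi.[t])%:P).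
Proof.
rewrite /along map_comp_poly rmorphD /= map_polyX map_polyC; congr (_ \Po _).
by apply/polyP => j; rewrite !coef_map /= /horner_eval horner_comp hornerXn.
Qed.

Lemma derivX_compXn e p :
  'X * (p \Po 'X^e)^`() = (e%:R *: 'X^e) * (p^`() \Po 'X^e).
Proof.
rewrite deriv_comp mulrCA mulrC; congr (_ * _).
rewrite derivXn scaler_nat; case: e => [|e]; first by rewrite !mulr0n mulr0.
by rewrite /= mulrnAr -exprS.
Qed.

Lemma evCM p P (t s : K) : (fiber t (p%:P * P)).[s] = p.[t] * (fiber t P).[s].
Proof. by rewrite rmorphM /= map_polyC hornerM hornerC. Qed.

Lemma evD P Q (t s : K) : (fiber t (P + Q)).[s] = (fiber t P).[s] + (fiber t Q).[s].
Proof. by rewrite rmorphD hornerD. Qed.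

(** The chain rule, multiplied by t so that t phi' appears. *)
Lemma dx_along e phi P :
  'X%:P * dx (along e phi P) =
    (e%:R *: 'X^e)%:P * along e phi (dx P) + ('X * phi^`())%:P * along e phi P^`().
Proof.
elim/poly_ind: P => [|P p IH].
  by rewrite /along deriv0 !(rmorph0, raddf0, comp_poly0, mulr0) addr0.
have -> : dx (P * 'X + p%:P) = dx P * 'X + (p^`())%:P.
  by rewrite raddfD /= dxM dxX mulr0 addr0 dxC.
have -> : (P * 'X + p%:P)^`() = P^`() * 'X + P.
  by rewrite derivD derivM derivX derivC addr0 mulr1.
have EA : along e phi (P^`() * 'X + P) = along e phi P^`() * ('X + phi%:P) + along e phi P.
  have := alongMXaddC e phi P^`() 0; rewrite polyC0 addr0 comp_poly0 polyC0 addr0 => <-.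
  by rewrite /along rmorphD comp_polyD.
rewrite EA !alongMXaddC raddfD /= dxM dxC raddfD /= dxX dxC add0r.
rewrite mulrDr mulrDr mulrA IH -!polyCM derivX_compXn.
rewrite !polyCM.
move: (along _ _ P) (along _ _ (dx P)) (along _ _ P^`()) => a b c.
move: (_ *: _)%:P (phi^`())%:P ((p^`() \Po 'X^e))%:P ('X%:P) => u v s r.
ring.
Qed.
Lemma ev_dx_along e (psi : {poly K}) P t s :
  let phi := 'X^e * psi in
  t * (fiber t (dx (along e phi P))).[s] =
    t ^+ e * (e%:R * ev (dx P) (t ^+ e) (phi.[t] + s) +
              (e%:R *: psi + 'X * psi^`()).[t] * ev P^`() (t ^+ e) (phi.[t] + s)).
Proof.
move=> phi; have := dx_along e phi P; rewrite /phi derivX_factor -/phi.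
move/(congr1 (fun G => (fiber t G).[s])); rewrite evD !evCM hornerX => ->.
rewrite hornerM hornerZ hornerXn !fiber_along !horner_comp hornerD hornerX hornerC.
rewrite [s + _]addrC mulrDr !mulrA; congr (_ * _ + _).
exact: mulrC.
Qed.
End Dx.

Section Branch.
Variable R : rcfType.
Notation C := (R[i]).
Implicit Types (x y z t w : C) (p q : {poly C}) (P A F Q : {poly {poly C}}).

Lemma maj_le (c : R) p q r : 0 <= c -> 0 <= r -> (forall k, nm p`_k <= c * nm q`_k) ->
  maj p r <= c * maj q r.
Proof.
move=> c0 r0 H; rewrite (maj_wide r (leq_maxl (size p) (size q))).
rewrite (maj_wide r (leq_maxr (size p) (size q))) mulr_sumr ler_sum // => k _.
by rewrite mulrA ler_wpM2r ?exprn_ge0.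
Qed.

Lemma derivX_le_coef Q : exists c : R, 1 <= c /\
  forall k t, c * nm t <= 1 -> nm (t * (Q`_k)^`().[t]) <= c * nm (Q`_k).[t].
Proof.
elim/poly_ind: Q => [|Q p [c [c1 H]]].
  by exists 1; split=> // k t _; rewrite coef0 deriv0 !horner0 mulr0 nm0 mulr0.
have [c' [c'1 H']] := derivX_le p.
exists (c + c'); split; first by lra.
move=> k t Ht.
have Hc : c * nm t <= 1 by apply: cnm_mono Ht; lra.
have Hc' : c' * nm t <= 1 by apply: cnm_mono Ht; lra.
rewrite coefD coefMX coefC; case: k => [|k] /=; rewrite ?add0r ?addr0.
  apply: le_trans (H' t Hc') _; rewrite ler_wpM2r ?nm_ge0 //; lra.
apply: le_trans (H k t Hc) _; rewrite ler_wpM2r ?nm_ge0 //; lra.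
Qed.

(** Everything at the branch point (x,w) is bounded by the gradient at the
    nearby point (x, w + rho) and by the Taylor majorant between both. *)
Definition branch_bounds P x w (c : R) : Prop := forall rho,
  let D := nm x * (nm (ev (dx P) x (w + rho)) + nm (ev P^`() x (w + rho)))
           + taylor_maj P x w (nm rho) in
  nm (ev P x w) <= c * D /\
  nm x * nm (ev (dx P) x w) <= c * (D + nm x * nm (ev P^`() x w)).

Lemma branch_bounds_mono P x w (c c' : R) : c <= c' ->
  branch_bounds P x w c -> branch_bounds P x w c'.
Proof.
move=> cc H rho; have [H1 H2] := H rho; set D := _ + taylor_maj _ _ _ _ in H1 H2 *.
have D0 : 0 <= D by rewrite addr_ge0 ?mulr_ge0 ?addr_ge0 ?nm_ge0 // maj_ge0 ?nm_ge0.
split; first by apply: le_trans H1 _; rewrite ler_wpM2r.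
by apply: le_trans H2 _; rewrite ler_wpM2r // addr_ge0 // mulr_ge0 ?nm_ge0.
Qed.

(** Let Q = P(t^e, phi + y) with coefficients U_k(t) in y. The chain rule
    expresses t dQ/dt at rho by the partial derivatives of P at the point
    (x, w + rho). Its terms of positive order in rho are at most
    c |U_k| |rho|^k because |t U_k'| <= c |U_k|, so t U_0' is bounded as
    stated. It dominates U_0 = P(x,w) as U_0(0) = 0; and for rho = 0 the chain
    rule recovers x dP/dx(x,w) from it. *)
Lemma branch_estimate P e (psi : {poly C}) : (0 < e)%N -> (P`_0).[0] = 0 ->
  exists c : R, 1 <= c /\ forall t, c * nm t <= 1 ->
    branch_bounds P (t ^+ e) ('X^e * psi).[t] c.
Proof.
move=> e0 P00; pose phi := 'X^e * psi; pose Q := along e phi P.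
pose chi := e%:R *: psi + 'X * psi^`().
have Q0t t : (Q`_0).[t] = ev P (t ^+ e) phi.[t].
  by rewrite -coef_fiber fiber_along coef_comp_polyXaddC nderivn0.
have Q00 : (Q`_0).[0] = 0.
  have phi0 : phi.[0] = 0 by rewrite hornerM hornerXn expr0n gtn_eqF // mul0r.
  by rewrite Q0t phi0 expr0n gtn_eqF // horner_coef0 coef_fiber.
have [c0 [c01 H0]] := derivX_ge Q00.
have [c1 [c11 H1]] := derivX_le_coef Q.
have [b [b1 Hb]] := poly_bounded chi.
pose c := c0 * (e%:R + b + c1).
have e1 : 1 <= e%:R :> R by rewrite (ler_nat _ 1).
have s1 : 1 <= e%:R + b + c1 by lra.
have cge0 : c0 <= c by apply: mul_ge1l.
have cge1 : e%:R + b + c1 <= c by rewrite /c mulrC; apply: mul_ge1l.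
exists c; split; first by lra.
move=> t Ht rho; set x := t ^+ e; set w := ('X^e * psi).[t]; move=> D.
have Ht0 : c0 * nm t <= 1 by apply: cnm_mono Ht.
have Ht1 : c1 * nm t <= 1 by apply: cnm_mono Ht; lra.
have t1 := cnm_le1 c01 Ht0.
pose u' := t * (Q`_0)^`().[t].
have key s : t * (fiber t (dx Q)).[s] =
    x * (e%:R * ev (dx P) x (w + s) + chi.[t] * ev P^`() x (w + s)).
  exact: ev_dx_along.
(* The terms of positive order in rho of t dQ/dt. *)
pose p2 := t%:P * fiber t (dx Q) - u'%:P.
have p2k k : nm p2`_k <= c1 * nm (fiber t Q - ((Q`_0).[t])%:P)`_k.
  rewrite /p2 !coefB !coefC coefCM !coef_fiber coef_map /=.
  case: k => [|k] /=; first by rewrite !subrr nm0 mulr0.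
  by rewrite !subr0; apply: H1.
have p2rho : nm p2.[rho] <= c1 * taylor_maj P x w (nm rho).
  apply: le_trans (nm_horner_maj _ _) _; apply: le_trans (maj_le _ _ p2k) _; rewrite ?nm_ge0 //; first by lra.
  by rewrite /taylor_maj -Q0t fiber_along.
have p20 : p2.[0] = 0.
  by rewrite horner_coef0 /p2 coefB coefCM coef_fiber coef_map coefC /= subrr.
have p2E s : u' = x * (e%:R * ev (dx P) x (w + s) + chi.[t] * ev P^`() x (w + s)) - p2.[s].
  by rewrite -key /p2 !hornerE; ring.
have T0 : 0 <= taylor_maj P x w (nm rho) by rewrite maj_ge0 // nm_ge0.
have Hu : nm u' <= (e%:R + b + c1) * D.
  rewrite (p2E rho); apply: le_trans (nmB _ _) _; rewrite nmM /D.
  have := nmD (e%:R * ev (dx P) x (w + rho)) (chi.[t] * ev P^`() x (w + rho)).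
  rewrite !nmM nm_nat; have := Hb t t1; move: p2rho.
  set X := nm x; set T := taylor_maj _ _ _ _ in T0 *; set g1 := nm (ev (dx P) _ _); set g2 := nm (ev P^`() _ _).
  have X0 : 0 <= X by rewrite nm_ge0.
  have g10 : 0 <= g1 by rewrite nm_ge0.
  have g20 : 0 <= g2 by rewrite nm_ge0.
  move=> h1 h2 h3.
  have h4 : nm chi.[t] * g2 <= b * g2 by rewrite ler_wpM2r.
  have h5 := ler_wpM2l X0 (le_trans h3 (lerD (lexx _) h4)).
  have : 0 <= (b + c1) * (X * g1) by rewrite !mulr_ge0 //; lra.
  have : 0 <= (e%:R + c1) * (X * g2) by rewrite !mulr_ge0 //; lra.
  have : 0 <= (e%:R + b) * T by rewrite !mulr_ge0 //; lra.
  lra.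
have D0 : 0 <= D by rewrite addr_ge0 // mulr_ge0 ?addr_ge0 ?nm_ge0.
split.
  rewrite -/phi -Q0t; apply: le_trans (H0 t Ht0) _.
  by rewrite /c -mulrA ler_wpM2l //; lra.
have := p2E 0; rewrite p20 subr0 addr0 => E2.
have : nm (x * (e%:R * ev (dx P) x w)) <= nm u' + nm (x * (chi.[t] * ev P^`() x w)).
  have -> : x * (e%:R * ev (dx P) x w) = u' - x * (chi.[t] * ev P^`() x w) by rewrite E2; ring.
  exact: nmB.
rewrite !nmM nm_nat; have := Hb t t1.
set X := nm x; set g1 := nm (ev (dx P) _ _); set g2 := nm (ev P^`() _ _).
have X0 : 0 <= X by rewrite nm_ge0.
have g10 : 0 <= X * g1 by rewrite mulr_ge0 ?nm_ge0.
have g20 : 0 <= X * g2 by rewrite mulr_ge0 ?nm_ge0.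
move=> h2; rewrite -[nm t * _]nmM -/u' => h3.
have h4 : nm chi.[t] * (X * g2) <= b * (X * g2) by rewrite ler_wpM2r.
have h5 : X * g1 <= e%:R * (X * g1) by rewrite ler_peMl.
have h6 : (e%:R + b + c1) * (D + X * g2) <= c * (D + X * g2) by rewrite ler_wpM2r // addr_ge0.
have h7 : 0 <= (e%:R + c1) * (X * g2) by rewrite mulr_ge0 //; lra.
lra.
Qed.
End Branch.

(** * Slope of the branches, selection of a branch *)

Section Slope.
Variable C : numClosedFieldType.
Implicit Types (p q : {poly C}) (P F : {poly {poly C}}).

(** The order of vanishing at the origin is at least m. *)
Definition ordge (m : nat) P := forall i j, (P`_j)`_i != 0 -> (m <= i + j)%N.

Lemma ordge_factor m P j : ordge m P -> exists g, P`_j = 'X^(m - j) * g.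
Proof.
move=> H; case: (dvdXn_case (m - j) P`_j) => // -[v [q [vm E q0]]].
have : (P`_j)`_v != 0 by rewrite E coefXnM ltnn subnn -horner_coef0.
by move/H; lia.
Qed.

(** If phi had order s < e, then in F(t^e,phi) the term of index mu would be
    the only one of lowest order, namely s mu < e n, contradicting that phi is a
    root modulo t^(e n). Geometrically: since F(0,y) has the same order as F,
    no branch through the origin is tangent to the y-axis. *)
Lemma branch_slope F mu e n (phi : {poly C}) : (0 < mu)%N -> (0 < e)%N ->
  ordge mu F -> (F`_mu)`_0 != 0 -> (mu <= n)%N -> phi.[0] = 0 ->
  (exists g, (ram e F).[phi] = 'X^(e * n) * g) ->
  exists psi, phi = 'X^e * psi.
Proof.
move=> mu0 e0 HF Fmu mun phi0 [g Hg].
case: (dvdXn_case e phi) => // -[s [psi [se Ephi psi0]]].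
have s0 : (0 < s)%N.
  by rewrite lt0n; apply: contraNneq psi0 => s0; move: phi0; rewrite Ephi s0 expr0 mul1r => ->.
pose D : {poly C} := 'X^((s * mu).+1).
pose T j := ((ram e F)`_j * phi ^+ j).
have HT j : j != mu -> exists h, T j = D * h.
  move=> jmu; rewrite /T coef_map /= Ephi exprMn -exprM.
  have [h ->] := ordge_factor j HF.
  rewrite comp_polyM comp_Xn_poly -exprM.
  have [k Ek] : exists k, (e * (mu - j) + s * j = (s * mu).+1 + k)%N.
    exists (e * (mu - j) + s * j - (s * mu).+1)%N; rewrite subnKC //.
    by case: (ltngtP j mu) jmu => // jm _; nia.
  exists ('X^k * ((h \Po 'X^e) * psi ^+ j)).
  rewrite /D !mulrA -exprD -Ek exprD; ring.
have [h Hh] : exists h, \sum_(j < size (ram e F) | nat_of_ord j != mu) T j = D * h.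
  elim/big_ind: _ => [|_ _ [h1 ->] [h2 ->]|j /HT //]; first by exists 0; rewrite mulr0.
  by exists (h1 + h2); rewrite mulrDr.
have Fm0 : (ram e F)`_mu != 0.
  rewrite coef_map /=; apply: contraNneq Fmu => F0.
  by rewrite -horner_coef0 -(_ : ('X^e).[0] = 0 :> C) -?horner_comp ?F0 ?horner0 // hornerXn expr0n gtn_eqF.
have mus : (mu < size (ram e F))%N.
  by rewrite ltnNge; apply: contra Fm0 => /leq_sizeP ->.
have : (ram e F).[phi] = 'X^(s * mu) * ((F`_mu \Po 'X^e) * psi ^+ mu + 'X * h).
  rewrite horner_coef (bigD1 (Ordinal mus)) //= -/(T mu).
  rewrite (eq_bigl (fun j : 'I_(size (ram e F)) => nat_of_ord j != mu)); last by move=> j; rewrite -val_eqE.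
  rewrite [X in _ + X]Hh /T coef_map /= Ephi exprMn -exprM /D exprSr; ring.
rewrite Hg => E.
have : (e * n <= s * mu)%N.
  apply: (@dvdXn_factor _ (e * n) (s * mu) ((F`_mu \Po 'X^e) * psi ^+ mu + 'X * h)); last by exists g.
  rewrite hornerD hornerM horner_comp hornerXn expr0n gtn_eqF //= hornerM hornerX mul0r addr0.
  by apply: mulf_neq0; [rewrite horner_coef0|rewrite horner_exp expf_neq0].
by move=> le; exfalso; have : (s * mu < e * n)%N; [nia | rewrite ltnNge le].
Qed.

End Slope.

Section Approx.
Variable R : rcfType.
Notation C := (R[i]).
Implicit Types (x y z t w : C) (p q : {poly C}) (P A F Q : {poly {poly C}}).

Lemma prod_pigeonhole (T : eqType) (s : seq T) (f : T -> R) (M : R) :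
  (0 < size s)%N -> 0 <= M -> (forall u, 0 <= f u) -> \prod_(u <- s) f u <= M ^+ size s ->
  exists2 u, u \in s & f u <= M.
Proof.
move=> s0 M0 f0 H.
case: (boolP (has (fun u => f u <= M) s)) => [/hasP [u us fu]|]; first by exists u.
move=> /hasPn nH; exfalso; move: H; apply/negP; rewrite -ltNge.
elim: s s0 nH => // u s IH _ nH.
have fu : M < f u by rewrite ltNge; apply: nH; rewrite mem_head.
rewrite big_cons exprS; case: s IH nH => [|v s] IH nH.
  by rewrite big_nil expr0 !mulr1.
have h := IH isT (fun u' us => nH u' (mem_behead (s := u :: v :: s) us)).
by apply: ltr_pM => //; rewrite ?exprn_ge0.
Qed.

Lemma uniform_const (T : eqType) (s : seq T) (Q : T -> R -> Prop) :
  (forall u c c', c <= c' -> Q u c -> Q u c') ->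
  (forall u, u \in s -> exists c, 1 <= c /\ Q u c) ->
  exists c, 1 <= c /\ forall u, u \in s -> Q u c.
Proof.
move=> mono; elim: s => [|u s IH] H; first by exists 1.
have [|c [c1 Hc]] := IH; first by move=> v vs; apply: H; rewrite in_cons vs orbT.
have [c' [c'1 Hc']] := H u (mem_head _ _).
exists (c + c'); split; first by lra.
move=> v; rewrite in_cons => /orP [/eqP ->|vs].
  by apply: mono Hc'; lra.
by apply: mono (Hc v vs); lra.
Qed.

Lemma exists_nroot e x : (0 < e)%N -> exists t, t ^+ e = x.
Proof.
move=> e0; have [t] : exists t, root ('X^e - x%:P) t.
  by apply/closed_rootP; rewrite size_XnsubC // eqSS -lt0n.
by rewrite /root !hornerE subr_eq0 => /eqP ?; exists t.
Qed.
End Approx.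

(** * Approximation of the polar curve by branches *)

Section Polar.
Variable R : rcfType.
Notation C := (R[i]).
Implicit Types (x y z t w : C) (p q : {poly C}) (P A F Q : {poly {poly C}}).

(** A root makes the product of the y - phi(t) as small as |x|^(n K), so one
    of the K factors is at most a constant times |x|^n. *)
Lemma root_near_branch F K n e (s : seq {poly C}) : (0 < K)%N ->
  size s = K -> cong (e * (n * K)) (ram e F) (\prod_(p <- s) ('X - p%:P)) ->
  exists c : R, 1 <= c /\ forall t y, nm t <= 1 -> nm y <= 1 -> ev F (t ^+ e) y = 0 ->
    exists2 p, p \in s & nm (y - p.[t]) <= c * nm (t ^+ e) ^+ n.
Proof.
move=> K0 sK [E HE]; have [c [c1 Hc]] := ev_bounded E (lexx 1).
exists c; split=> // t y t1 y1 F0.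
have c0 : 0 <= c by lra.
have := congr1 (fun G => ev G t y) HE.
rewrite evD evCM hornerXn.
have -> : ev (ram e F) t y = 0.
  rewrite -[RHS]F0; congr (_.[_]); apply/polyP => j.
  by rewrite !coef_map /= /horner_eval horner_comp hornerXn.
have -> : ev (\prod_(p <- s) ('X - p%:P)) t y = \prod_(p <- s) (y - p.[t]).
  rewrite rmorph_prod horner_prod; apply: eq_bigr => p _.
  by rewrite rmorphB /= map_polyX map_polyC hornerD hornerN hornerX hornerC.
move/eqP; rewrite eq_sym addr_eq0 => /eqP /(congr1 nm).
rewrite nm_prod nmN nmM nmX => Hp.
apply: prod_pigeonhole; rewrite ?sK ?mulr_ge0 ?exprn_ge0 ?nm_ge0 //.
  by move=> u; rewrite nm_ge0.
rewrite Hp nmX -!exprM exprMn mulrC -exprM mulnA.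
rewrite ler_wpM2r ?exprn_ge0 ?nm_ge0 //.
apply: le_trans (Hc t y t1 y1) _; rewrite -[leLHS]expr1 ler_weXn2l //.
Qed.

(** Branches with phi(0) <> 0 stay away from the origin and cannot be close to
    a small root, so for them the claim holds vacuously. *)
Lemma polar_approx P F (a : C) K mu n : a != 0 -> P^`() = a%:P%:P * F ->
  F \is monic -> size F = K.+1 -> ordge mu F -> (F`_mu)`_0 != 0 -> (0 < mu)%N ->
  (mu <= n * K)%N -> (0 < K)%N -> (0 < n)%N -> (P`_0)`_0 = 0 ->
  exists c : R, 1 <= c /\ forall x y, c * nm x <= 1 -> c * nm y <= 1 ->
    ev F x y = 0 ->
    exists w, nm (y - w) <= c * nm x ^+ n /\ branch_bounds P x w c.
Proof.
move=> a0 PF mF sF oF Fmu mu0 munK K0 n0 P00.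
have [e [s [e0 sK Hs]]] := puiseux mF sF (n * K).
have [c1 [c11 H1]] := root_near_branch K0 sK Hs.
have [c2 [c21 H2]] : exists c : R, 1 <= c /\ forall p, p \in s ->
    forall t, c * nm t <= 1 -> c * nm p.[t] < 1 -> branch_bounds P (t ^+ e) p.[t] c.
  apply: (@uniform_const R _ s (fun p c => forall t, c * nm t <= 1 -> c * nm p.[t] < 1 -> branch_bounds P (t ^+ e) p.[t] c)).
    move=> p c c' cc H t t1 p1; apply: (branch_bounds_mono cc); apply: H.
      exact: cnm_mono cc t1.
    by apply: le_lt_trans p1; rewrite ler_wpM2r ?nm_ge0.
  move=> p ps; have [p0|p0] := eqVneq p.[0] 0; last first.
    have [c [cg1 Hc]] := poly_unit_bound p0.
    by exists c; split=> // t /Hc h1 h2; exfalso; move: h2; rewrite ltNge h1.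
  have [|psi Epsi] := branch_slope mu0 e0 oF Fmu munK p0.
    have [E HE] := Hs; exists (E.[p]); rewrite HE hornerD hornerM hornerC horner_prod.
    rewrite [X in X + _](_ : _ = 0) ?add0r //.
    by rewrite (big_rem p ps) /= !hornerE subrr mul0r.
  have P00' : (P`_0).[0] = 0 by rewrite horner_coef0.
  have [c [cg1 Hc]] := branch_estimate psi e0 P00'.
  by exists c; split=> // t t1 _; rewrite Epsi; apply: Hc.
pose c := c2 ^+ e + 4 * c2 * c1.
have c2e : 1 <= c2 ^+ e by rewrite exprn_ege1.
have c2e2 : c2 <= c2 ^+ e by rewrite -[leLHS]expr1 ler_weXn2l.
have c12 : c1 <= c2 * c1 by rewrite ler_peMl //; lra.
have c21' : c2 <= c2 * c1 by rewrite ler_peMr //; lra.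
exists c; split; first by rewrite /c; lra.
move=> x y Hx Hy F0.
have [t tx] := exists_nroot x e0.
have xe : nm t ^+ e = nm x by rewrite -nmX tx.
have c2t : c2 * nm t <= 1.
  rewrite -(@expr_le1 _ e) ?mulr_ge0 ?nm_ge0 //; last by lra.
  by rewrite exprMn xe; apply: cnm_mono Hx; rewrite /c; lra.
have t1 := cnm_le1 c21 c2t.
have cc : 1 <= c by rewrite /c; lra.
have y1 := cnm_le1 cc Hy; have x1 := cnm_le1 cc Hx.
have [|p ps Hp] := H1 t y t1 y1; first by rewrite tx.
have xn : nm x ^+ n <= nm x.
  by case: (n) n0 => // k _; rewrite exprS ler_piMr ?nm_ge0 // exprn_ile1 ?nm_ge0.
have x0 := nm_ge0 x; have y0 := nm_ge0 y.
have xn0 : 0 <= nm x ^+ n by rewrite exprn_ge0.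
rewrite tx in Hp.
exists p.[t]; split.
  by apply: le_trans Hp _; rewrite ler_wpM2r // /c; lra.
apply: (branch_bounds_mono (c := c2)); first by rewrite /c; lra.
rewrite -tx; apply: H2 => //.
have h1 : nm p.[t] <= nm y + c1 * nm x.
  have := nm_ler_sub p.[t] y; rewrite nmBC.
  have : c1 * nm x ^+ n <= c1 * nm x by rewrite ler_wpM2l //; lra.
  lra.
have h2 : c2 * (4 * nm y) <= 1.
  apply: le_trans Hy; rewrite mulrA ler_wpM2r // /c; lra.
have h3 : c2 * (4 * (c1 * nm x)) <= 1.
  apply: le_trans Hx; rewrite !mulrA ler_wpM2r // /c; lra.
have := ler_wpM2l (le_trans ler01 c21) h1; lra.
Qed.

End Polar.

(** * Elementary real inequalities *)

Section RealInequalities.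
Variable R : realFieldType.
Implicit Types (C X r F G T h g u v f tp p Z Y : R).

(** In this section X = |x|, G is the size of the gradient at z0 = (x,y0), r and
    r' are the distances from y0 to the root y1 and to the branch point w, T is
    the approximation error X^n, tp the Taylor majorant from w to y0; h, g are
    the moduli of P, dP/dx at (x,y1), and u, v, f those of P, dP/dx, dP/dy at
    (x,w). *)
Lemma taylor_error_bound C r F G T r' tp : 1 <= C -> 0 <= r -> r <= 1 -> 0 <= T -> T <= 1 ->
  0 <= F -> F <= G -> G <= C ->
  r' <= r + C * T -> tp <= C * r' * (F + T) -> tp <= C * r * G + 3 * C ^+ 3 * T.
Proof.
move=> C1 r0 r1 T0 T1 F0 FG GC hr' htp.
have C0 : 0 <= C by lra.
have FT0 : 0 <= C * (F + T) by rewrite mulr_ge0 // addr_ge0.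
have := ler_wpM2l FT0 hr'; rewrite (_ : C * (F + T) * r' = C * r' * (F + T)); last by ring.
move=> h1; apply: le_trans (le_trans htp h1) _.
have C2 : C <= C * C by rewrite ler_peMr.
have C3 : C * C <= C * C * C by rewrite ler_peMr // mulr_ge0.
have -> : C ^+ 3 = C * C * C by rewrite !exprS expr0; ring.
have e1 : C * r * F <= C * r * G by rewrite ler_wpM2l // mulr_ge0.
have e2 : C * r * T <= C * T by rewrite ler_wpM2r // ler_piMr.
have e3 : C * C * (F * T) <= C * C * (C * T).
  by rewrite ler_wpM2l ?mulr_ge0 // ler_wpM2r //; lra.
have e4 : C * C * (T * T) <= C * C * T by rewrite ler_wpM2l ?mulr_ge0 // ler_piMr.
have e5 : C * T <= C * C * T by rewrite ler_wpM2r.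
have e6 : C * C * T <= C * C * C * T by rewrite ler_wpM2r.
have -> : C * (F + T) * (r + C * T) = C * r * F + C * r * T + C * C * (F * T) + C * C * (T * T) by ring.
have -> : 3 * (C * C * C) * T = 3 * (C * C * C * T) by ring.
have e7 : C * C * (C * T) = C * C * C * T by ring.
lra.
Qed.

(** With Z = |x|^(dK), the error T is at most X Z <= C X h by the gap, so for
    small X it can be absorbed into h. *)
Lemma value_at_foot_bound C X r G T h u tp Z : 1 <= C -> 0 <= X -> 0 <= r -> 0 <= T -> 0 <= G ->
  8 * C ^+ 5 * X <= 1 -> 
  tp <= C * r * G + 3 * C ^+ 3 * T -> u <= C * (X * G + tp) -> h <= u + C * T ->
  T <= X * Z -> Z <= C * h -> 0 <= h ->
  h <= 2 * C ^+ 2 * ((X + r) * G).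
Proof.
move=> C1 X0 r0 T0 G0 small htp hu hh hT hZ h0.
have C0 : 0 <= C by lra.
have := ler_wpM2l C0 htp => h1.
have C2 : C <= C ^+ 2 by rewrite -[leLHS]expr1 ler_weXn2l.
have C4 : C <= C ^+ 4 by rewrite -[leLHS]expr1 ler_weXn2l.
have C5 : C ^+ 5 = C ^+ 4 * C by rewrite exprSr.
have E4 : C * (3 * C ^+ 3 * T) = 3 * (C ^+ 4 * T) by rewrite [C ^+ 4]exprS; ring.
have E2 : C * (C * r * G) = C ^+ 2 * (r * G) by ring.
have XG : C * (X * G) <= C ^+ 2 * (X * G) by rewrite ler_wpM2r // mulr_ge0.
have CT : C * T <= C ^+ 4 * T by rewrite ler_wpM2r.
have hh2 : h <= C ^+ 2 * ((X + r) * G) + 4 * (C ^+ 4 * T).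
  have -> : C ^+ 2 * ((X + r) * G) = C ^+ 2 * (X * G) + C ^+ 2 * (r * G) by ring.
  move: hu h1; rewrite !mulrDr E4 E2; lra.
have T2 : T <= X * (C * h) by apply: le_trans hT _; rewrite ler_wpM2l.
have C40 : 0 <= C ^+ 4 by rewrite exprn_ge0.
have T3 := ler_wpM2l C40 T2.
have T4 : C ^+ 4 * (X * (C * h)) = C ^+ 5 * (X * h) by rewrite C5; ring.
have := ler_wpM2r h0 small; rewrite mul1r -!mulrA.
move: T3; rewrite T4; lra.
Qed.

(** The branch estimate with rho = 0; again T is absorbed into h. *)
Lemma value_le_polar_derivative C X T h g u v f Z : 1 <= C -> 0 <= X -> X <= 1 -> 0 <= T -> 
  6 * C ^+ 5 * X <= 1 -> 
  u <= C * (X * (v + f)) -> h <= u + C * T -> v <= g + C * T -> f <= C * T ->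
  T <= X * Z -> Z <= C * h -> 0 <= h ->
  h <= 2 * C * (X * g).
Proof.
move=> C1 X0 X1 T0 small hu hh hv hf hT hZ h0.
have C0 : 0 <= C by lra.
have vf : v + f <= g + 2 * (C * T) by lra.
have := ler_wpM2l C0 (ler_wpM2l X0 vf) => h1.
have XT : C * (X * (C * T)) <= C ^+ 2 * T.
  have -> : C * (X * (C * T)) = X * (C ^+ 2 * T) by ring.
  by rewrite ler_piMl // mulr_ge0 ?exprn_ge0.
have CT : C * T <= C ^+ 2 * T by rewrite ler_wpM2r // -[leLHS]expr1 ler_weXn2l.
have hh2 : h <= C * (X * g) + 3 * (C ^+ 2 * T).
  have E : C * (X * (g + 2 * (C * T))) = C * (X * g) + 2 * (C * (X * (C * T))) by ring.
  move: h1; rewrite E; lra.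
have T2 : T <= X * (C * h) by apply: le_trans hT _; rewrite ler_wpM2l.
have C20 : 0 <= C ^+ 2 by rewrite exprn_ge0.
have T3 := ler_wpM2l C20 T2.
have C3 : C ^+ 3 * (X * h) <= C ^+ 5 * (X * h) by rewrite ler_wpM2r ?mulr_ge0 // ler_weXn2l.
have T4 : C ^+ 2 * (X * (C * h)) = C ^+ 3 * (X * h) by rewrite [C ^+ 3]exprSr; ring.
have := ler_wpM2r h0 small; rewrite mul1r -!mulrA.
move: T3; rewrite T4; lra.
Qed.

(** Here T is absorbed into Y = X^(N+1), which the gap bounds by X g. *)
Lemma abscissa_pow_bound C X r G T g v f tp Y : 1 <= C -> 0 <= X -> X <= 1 -> 0 <= r -> 0 <= T -> 0 <= G ->
  10 * C ^+ 5 * X <= 1 ->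
  tp <= C * r * G + 3 * C ^+ 3 * T -> X * v <= C * (X * G + tp + X * f) ->
  g <= v + C * T -> f <= C * T -> T <= X * Y -> Y <= C * (X * g) -> 0 <= Y ->
  Y <= 2 * C ^+ 3 * ((X + r) * G).
Proof.
move=> C1 X0 X1 r0 T0 G0 small htp hv hg hf hT hY Y0.
have C0 : 0 <= C by lra.
have Xg := ler_wpM2l X0 hg.
have CT0 : 0 <= C * T by rewrite mulr_ge0.
have XT : X * (C * T) <= C * T by rewrite ler_piMl.
have Xf : X * f <= C * T by apply: le_trans XT; rewrite ler_wpM2l.
have h1 : X * g <= C * (X * G + tp + C * T) + C * T.
  have := ler_wpM2l C0 (lerD (lexx (X * G + tp)) Xf); move: Xg; rewrite mulrDr; lra.
have C24 : C ^+ 2 <= C ^+ 4 by rewrite ler_weXn2l.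
have C14 : C <= C ^+ 4 by rewrite -[leLHS]expr1 ler_weXn2l.
have e1 := ler_wpM2l C0 htp.
have e2 : C * (C * r * G + 3 * C ^+ 3 * T) = C ^+ 2 * (r * G) + 3 * (C ^+ 4 * T).
  by rewrite [C ^+ 4]exprS; ring.
have e3 : C * (X * G) <= C ^+ 2 * (X * G).
  by rewrite ler_wpM2r ?mulr_ge0 // -[leLHS]expr1 ler_weXn2l.
have e4 : C * (C * T) <= C ^+ 4 * T by rewrite mulrA ler_wpM2r // -expr2.
have e5 : C * T <= C ^+ 4 * T by rewrite ler_wpM2r.
have h2 : X * g <= C ^+ 2 * ((X + r) * G) + 5 * (C ^+ 4 * T).
  have -> : C ^+ 2 * ((X + r) * G) = C ^+ 2 * (X * G) + C ^+ 2 * (r * G) by ring.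
  move: h1 e1; rewrite e2 !mulrDr; lra.
have h3 := ler_wpM2l C0 h2.
have e6 : C * (C ^+ 2 * ((X + r) * G) + 5 * (C ^+ 4 * T)) = C ^+ 3 * ((X + r) * G) + 5 * (C ^+ 5 * T).
  by rewrite [C ^+ 3]exprS [C ^+ 5]exprS; ring.
have C50 : 0 <= C ^+ 5 by rewrite exprn_ge0.
have e7 := ler_wpM2l C50 hT.
have e8 := ler_wpM2r Y0 small; rewrite mul1r -!mulrA in e8.
move: h3; rewrite e6; lra.
Qed.

(** If r dominates, use that G bounds r^K; otherwise cancel one factor X. *)
Lemma distance_pow_bound C X r G K : (0 < K)%N -> 1 <= C -> 0 <= X -> 0 <= r -> 0 <= G -> G <= C ->
  r ^+ K <= C * G -> (X <= r \/ 0 < X /\ X ^+ (K * K).+1 <= 2 * C ^+ 3 * ((X + r) * G)) ->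
  (X + r) ^+ (K * K) <= 2 ^+ (K * K) * (4 * C ^+ 3 * C ^+ (2 * K)) * G.
Proof.
move=> K0 C1 X0 r0 G0 GC hr hX.
have C0 : 0 <= C by lra.
have C3 : 1 <= C ^+ 3 by rewrite exprn_ege1.
have C2K : 1 <= C ^+ (2 * K) by rewrite exprn_ege1.
have X2 : 0 <= (2 : R) ^+ (K * K) by rewrite exprn_ge0.
have -> : 2 ^+ (K * K) * (4 * C ^+ 3 * C ^+ (2 * K)) * G =
  2 ^+ (K * K) * (4 * (C ^+ 3 * (C ^+ (2 * K) * G))) by rewrite !mulrA.
have dom : X <= r -> (X + r) ^+ (K * K) <= 2 ^+ (K * K) * (4 * (C ^+ 3 * (C ^+ (2 * K) * G))).
  move=> rX; apply: (@le_trans _ _ ((2 * r) ^+ (K * K))).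
    by rewrite lerXn2r ?nnegrE ?mulr_ge0 ?addr_ge0 //; lra.
  rewrite exprMn ler_wpM2l // exprM.
  apply: (@le_trans _ _ ((C * G) ^+ K)).
    by rewrite lerXn2r ?nnegrE ?exprn_ge0 ?mulr_ge0.
  rewrite exprMn; case: K K0 {hr hX X2} C2K => // K _ C2K.
  have -> : C ^+ K.+1 * G ^+ K.+1 = (C ^+ K.+1 * G ^+ K) * G by rewrite [G ^+ _]exprSr; ring.
  rewrite !mulrA ler_wpM2r //.
  apply: (@le_trans _ _ (C ^+ (2 * K.+1))).
    rewrite mul2n -addnn exprD ler_wpM2l ?exprn_ge0 //.
    apply: (@le_trans _ _ (C ^+ K)); first by rewrite lerXn2r ?nnegrE.
    by rewrite ler_weXn2l.
  by rewrite ler_peMl ?exprn_ge0 //; lra.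
case: hX => [|[Xp hX]]; first exact: dom.
case: (lerP r X) => rX; last by apply: dom; exact: ltW.
apply: (@le_trans _ _ ((2 * X) ^+ (K * K))).
  by rewrite lerXn2r ?nnegrE ?mulr_ge0 ?addr_ge0 //; lra.
rewrite exprMn ler_wpM2l //.
have h1 : X ^+ (K * K).+1 <= (4 * C ^+ 3 * G) * X.
  apply: le_trans hX _; have : (X + r) * G <= 2 * X * G by rewrite ler_wpM2r //; lra.
  move/(ler_wpM2l (_ : 0 <= 2 * C ^+ 3)); have C30 : 0 <= 2 * C ^+ 3 by lra.
  move/(_ C30)=> h; apply: le_trans h _; rewrite le_eqVlt; apply/orP; left; apply/eqP; ring.
move: h1; rewrite exprSr ler_pM2r // => h1; apply: le_trans h1 _.
have g1 : G <= C ^+ (2 * K) * G by rewrite ler_peMl.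
have C43 : 0 <= 4 * C ^+ 3 by lra.
by have := ler_wpM2l C43 g1; rewrite !mulrA.
Qed.

(** If h = 0 there is nothing to absorb: |P(z0)| <= C r G, and the bound on the
    power of r + X is used with X replaced by 0. *)
Lemma inequality_from_estimates C X r G h g u v f tp p K n N' : (0 < K)%N -> n = (N' + K * K + 2)%N ->
  1 <= C -> 0 <= X -> X <= 1 -> 0 <= r -> 0 <= G -> G <= C -> 10 * C ^+ 5 * X <= 1 ->
  0 <= h -> 0 <= p ->
  r ^+ K <= C * G -> p <= h + C * r * G ->
  h <= u + C * X ^+ n -> g <= v + C * X ^+ n -> v <= g + C * X ^+ n -> f <= C * X ^+ n ->
  tp <= C * r * G + 3 * C ^+ 3 * X ^+ n ->
  u <= C * (X * G + tp) -> X * v <= C * (X * G + tp + X * f) -> u <= C * (X * (v + f)) ->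
  h = 0 \/ X ^+ N' <= C * h -> g = 0 \/ X ^+ (K * K) <= C * g ->
  p ^+ (K * K) <= (3 * C ^+ 2) ^+ (K * K) *
     (2 ^+ (K * K) * (4 * C ^+ 3 * C ^+ (2 * K))) * G ^+ (K * K).+1.
Proof.
move=> K0 nE C1 X0 X1 r0 G0 GC small h0 p0 rG ph hu gv vg fT tpT A1 A2 A3 gaph gapg.
have C0 : 0 <= C by lra.
have C20 : 0 <= C ^+ 2 by rewrite exprn_ge0.
have fin (X' : R) : 0 <= X' -> p <= 3 * C ^+ 2 * ((X' + r) * G) ->
   (X' <= r \/ 0 < X' /\ X' ^+ (K * K).+1 <= 2 * C ^+ 3 * ((X' + r) * G)) ->
   p ^+ (K * K) <= (3 * C ^+ 2) ^+ (K * K) *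
     (2 ^+ (K * K) * (4 * C ^+ 3 * C ^+ (2 * K))) * G ^+ (K * K).+1.
  move=> X'0 hp hX'; have := distance_pow_bound K0 C1 X'0 r0 G0 GC rG hX' => hpow.
  have q0 : 0 <= 3 * C ^+ 2 * ((X' + r) * G) by rewrite !mulr_ge0 ?addr_ge0.
  apply: (@le_trans _ _ ((3 * C ^+ 2 * ((X' + r) * G)) ^+ (K * K))).
    by rewrite lerXn2r ?nnegrE.
  set a := 3 * C ^+ 2; set b := _ * (4 * _ * _) in hpow *.
  have a0 : 0 <= a ^+ (K * K) by rewrite exprn_ge0 // mulr_ge0.
  rewrite exprMn [((X' + r) * G) ^+ _]exprMn exprS.
  have -> : a ^+ (K * K) * b * (G * G ^+ (K * K)) = a ^+ (K * K) * (b * G * G ^+ (K * K)) by ring.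
  by rewrite ler_wpM2l // ler_wpM2r // exprn_ge0.
have [hz|h0'] := eqVneq h 0.
  apply: (fin 0); [by []| |by left].
  move: ph; rewrite hz !add0r => ph; apply: le_trans ph _; rewrite -mulrA ler_wpM2r ?mulr_ge0 //.
  have : C <= C ^+ 2 by rewrite -[leLHS]expr1 ler_weXn2l.
  lra.
have hp : 0 < h by rewrite lt_def h0'.
have {}gaph : X ^+ N' <= C * h by case: gaph => // hz; rewrite hz eqxx in h0'.
have T0 : 0 <= X ^+ n by rewrite exprn_ge0.
have TN' : X ^+ n <= X * X ^+ N'.
  by rewrite -exprS ler_wiXn2l // nE addn2 ltnS leqW // leq_addr.
have TN : X ^+ n <= X * X ^+ (K * K).+1.
  by rewrite -exprS ler_wiXn2l // nE addn2 !ltnS leq_addl.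
have C50 : 0 <= C ^+ 5 * X by rewrite mulr_ge0 // exprn_ge0.
have s8 : 8 * C ^+ 5 * X <= 1 by move: small C50; clear; lra.
have s6 : 6 * C ^+ 5 * X <= 1 by move: small C50; clear; lra.
have hb := value_at_foot_bound C1 X0 r0 T0 G0 s8 tpT A1 hu TN' gaph h0.
have hg := value_le_polar_derivative C1 X0 X1 T0 s6 A3 hu vg fT TN' gaph h0.
have gn0 : g != 0.
  by apply: contraTneq hp => g0; rewrite -leNgt; move: hg; rewrite g0 !mulr0.
have Xp : 0 < X.
  by rewrite lt_def X0 andbT; apply: contraTneq hp => Xz; rewrite -leNgt; move: hg; rewrite Xz mul0r !mulr0.
have {}gapg : X ^+ (K * K) <= C * g by case: gapg => // gz; rewrite gz eqxx in gn0.
have Yg : X ^+ (K * K).+1 <= C * (X * g) by rewrite exprS mulrCA ler_wpM2l.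
have Y0 : 0 <= X ^+ (K * K).+1 by rewrite exprn_ge0.
have Xb := abscissa_pow_bound C1 X0 X1 r0 T0 G0 small tpT A2 gv fT TN Yg Y0.
apply: (fin X) => //; last by right.
have XG : 0 <= X * G by rewrite mulr_ge0.
have rG0 : 0 <= r * G by rewrite mulr_ge0.
have C12 : C <= C ^+ 2 by rewrite -[leLHS]expr1 ler_weXn2l.
have e1 := ler_wpM2r rG0 C12; have e2 := mulr_ge0 C20 XG.
move: hb ph e1 e2; clear; lra.
Qed.
End RealInequalities.

(** * Comparison with the nearest point of the polar curve *)

Section Core.
Variable R : rcfType.
Notation C := (R[i]).
Implicit Types (x y z t w : C) (p q : {poly C}) (P A F Q : {poly {poly C}}).

Lemma ev_near0 A : exists c : R, 1 <= c /\ forall x y, nm x <= 1 -> nm y <= 1 ->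
  nm (ev A x y - (A`_0)`_0) <= c * (nm x + nm y).
Proof.
have [c [c1 Hc]] := ev_lipschitz A (lexx 1).
have [b [b1 Hb]] := poly_bounded (drop_poly 1 A`_0).
exists (c + b); split; first by lra.
move=> x y x1 y1.
have E : ev A x 0 - (A`_0)`_0 = (drop_poly 1 A`_0).[x] * x.
  rewrite horner_coef0 coef_fiber -[in LHS](poly_take_drop 1 A`_0) hornerD hornerM expr1 hornerX.
  rewrite [X in X.[x]](_ : _ = ((A`_0)`_0)%:P) ?hornerC ?coefD ?coefMX ?coef_take_poly ?addr0 /= .
    ring.
  by apply/polyP => i; rewrite coef_take_poly coefC; case: i.
have := Hc x y 0 x1 y1; rewrite nm0 => /(_ ler01); rewrite subr0 => h1.
have := nmD (ev A x y - ev A x 0) (ev A x 0 - (A`_0)`_0).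
rewrite subrKA E nmM; have := Hb x x1 => h2 h3.
have := ler_wpM2r (nm_ge0 x) h2 => h4.
have h5 : 0 <= c * nm x by rewrite mulr_ge0 ?nm_ge0 //; lra.
have h6 : 0 <= b * nm y by rewrite mulr_ge0 ?nm_ge0 //; lra.
rewrite mulrDr !mulrDl; lra.
Qed.

Lemma nearest_root (y0 : C) (ys : seq C) : (0 < size ys)%N ->
  exists2 y1, y1 \in ys & forall y, y \in ys -> nm (y0 - y1) <= nm (y0 - y).
Proof.
elim: ys => // y ys IH _; case: (posnP (size ys)) => [/size0nil ->|/IH [y1 y1s H]].
  by exists y; rewrite ?mem_head // => z; rewrite inE => /eqP ->.
case: (lerP (nm (y0 - y)) (nm (y0 - y1))) => le.
  exists y; rewrite ?mem_head // => z; rewrite in_cons => /orP [/eqP -> //|/H].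
  exact: le_trans.
exists y1; first by rewrite in_cons y1s orbT.
by move=> z; rewrite in_cons => /orP [/eqP ->|/H //]; apply: ltW.
Qed.

(** The perturbation of a product of bounded factors is linear in b. *)
Lemma prod_add_le (s : seq C) (u : C -> R) (U b : R) : 0 <= b ->
  (forall y, y \in s -> 0 <= u y <= U) -> 0 <= U ->
  \prod_(y <- s) (u y + b) <= \prod_(y <- s) u y + b * (U + b + 1) ^+ size s.
Proof.
move=> b0; elim: s => [|y s IH] H U0; first by rewrite !big_nil expr0 mulr1 lerDl.
have Hs z : z \in s -> 0 <= u z <= U by move=> zs; apply: H; rewrite in_cons zs orbT.
have /andP [uy0 uyU] := H y (mem_head _ _).
have M0 : 0 <= (U + b + 1) ^+ size s by rewrite exprn_ge0 //; lra.
have ub : \prod_(z <- s) (u z + b) <= (U + b + 1) ^+ size s.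
  by apply: prod_le_exp => z /Hs; lra.
rewrite !big_cons exprS /=; set M := _ ^+ size s in M0 ub *.
have := ler_wpM2l uy0 (IH Hs U0); rewrite -/M => h1; have := ler_wpM2l b0 ub => h2.
have h3 : u y * (b * M) <= U * (b * M) by rewrite ler_wpM2r // mulr_ge0.
have h4 : 0 <= b * (b * M) by rewrite !mulr_ge0.
lra.
Qed.

Lemma le_prod_seq (s : seq C) (u v : C -> R) : (forall y, y \in s -> 0 <= u y <= v y) ->
  \prod_(y <- s) u y <= \prod_(y <- s) v y.
Proof. by move=> H; rewrite !big_seq; apply: ler_prod => y /H. Qed.

Lemma exp_le_prod (s : seq C) (u : C -> R) (r : R) : 0 <= r -> (forall y, y \in s -> r <= u y) ->
  r ^+ size s <= \prod_(y <- s) u y.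
Proof.
move=> r0 H; rewrite -[leLHS](_ : \prod_(y <- s) r = _); last by rewrite big_const_seq count_predT iter_mulr_1.
by apply: le_prod_seq => y ys; rewrite r0 H.
Qed.

Section PolarEstimates.
Variables (P F : {poly {poly C}}) (a : C) (K : nat).
Hypotheses (PF : P^`() = a%:P%:P * F) (mF : F \is monic) (sF : size F = K.+1).

Lemma ev_polar x y : ev P^`() x y = a * ev F x y.
Proof. by rewrite PF evCM hornerC. Qed.

Lemma fiber_polar x (ys : seq C) : fiber x F = \prod_(y <- ys) ('X - y%:P) ->
  fiber x P^`() = a%:P * \prod_(y <- ys) ('X - y%:P).
Proof. by move=> <-; rewrite PF rmorphM /= map_polyC /= /horner_eval hornerC. Qed.

Lemma nm_ev_prod x y0 (ys : seq C) : fiber x F = \prod_(y <- ys) ('X - y%:P) ->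
  nm (ev F x y0) = \prod_(y <- ys) nm (y0 - y).
Proof.
move=> ->; rewrite horner_prod nm_prod; apply: eq_bigr => y _.
by rewrite hornerD hornerN hornerX hornerC.
Qed.

(** For the nearest root y1, r + |y - y1| <= 3 |y0 - y| for every root y, and
    the product of the |y0 - y| is the modulus of F(x,y0). *)
Lemma taylor_maj_root x y0 y1 (ys : seq C) : size ys = K ->
  fiber x F = \prod_(y <- ys) ('X - y%:P) ->
  (forall y, y \in ys -> nm (y0 - y1) <= nm (y0 - y)) ->
  taylor_maj P x y1 (nm (y0 - y1)) <= 3 ^+ K * nm (y0 - y1) * nm (ev P^`() x y0).
Proof.
move=> sy Ey near; set r := nm (y0 - y1) in near *.
have r0 : 0 <= r by rewrite nm_ge0.
apply: le_trans (taylor_maj_le y1 r0 (fiber_polar Ey)) _.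
rewrite [3 ^+ K * r]mulrC -mulrA ler_wpM2l // ev_polar nmM mulrCA ler_wpM2l ?nm_ge0 //.
rewrite (nm_ev_prod _ Ey) -sy.
rewrite -[3 ^+ _](_ : \prod_(y <- ys) 3 = _); last by rewrite big_const_seq count_predT iter_mulr_1.
rewrite -big_split /=; apply: le_prod_seq => y /near ry.
have h1 : nm (y - y1) <= nm (y0 - y) + r.
  have -> : y - y1 = (y0 - y1) - (y0 - y) by ring.
  by have := nmB (y0 - y1) (y0 - y); rewrite -/r; lra.
have := nm_ge0 (y - y1); lra.
Qed.

(** The same comparison at a point w close to y1; the displacement only adds a
    multiple of T, because the roots are bounded. *)
Lemma taylor_maj_branch (b : R) : 1 <= b -> degle K F -> exists c : R, 1 <= c /\
  forall x y0 y1 w (T : R) (ys : seq C), nm x <= 1 -> nm y0 <= 1 -> 0 <= T -> T <= 1 ->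
    size ys = K -> fiber x F = \prod_(y <- ys) ('X - y%:P) ->
    (forall y, y \in ys -> nm (y0 - y1) <= nm (y0 - y)) ->
    nm (y1 - w) <= b * T ->
    taylor_maj P x w (nm (y0 - w)) <= c * nm (y0 - w) * (nm (ev P^`() x y0) + T).
Proof.
move=> b1 dF; have [B [B1 HB]] := root_bound mF sF dF.
pose U := 3 * (1 + B); pose M := (U + 2 * b + 1) ^+ K.
have U0 : 0 <= U by rewrite /U; lra.
have M0 : 0 <= M by rewrite exprn_ge0 //; lra.
have a0 := nm_ge0 a.
have p3 : 1 <= 3 ^+ K :> R by rewrite exprn_ege1 //; lra.
have aM : 0 <= nm a * (2 * b * M) by rewrite !mulr_ge0 //; lra.
exists (3 ^+ K + nm a * (2 * b * M)); split; first by lra.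
move=> x y0 y1 w T ys x1 y01 T0 T1 sy Ey near y1w.
set r := nm (y0 - w); have r0 : 0 <= r by rewrite nm_ge0.
have bT0 : 0 <= b * T by rewrite mulr_ge0 //; lra.
have hr y : y \in ys -> r <= nm (y0 - y) + b * T.
  move=> /near h; have := nmD (y0 - y1) (y1 - w); rewrite subrKA -/r; lra.
apply: le_trans (taylor_maj_le w r0 (fiber_polar Ey)) _.
rewrite [leRHS]mulrAC [leRHS]mulrC ler_wpM2l //.
have h1 : \prod_(y <- ys) (r + nm (y - w)) <= \prod_(y <- ys) (3 * nm (y0 - y) + 2 * (b * T)).
  apply: le_prod_seq => y /hr ry; rewrite addr_ge0 ?nm_ge0 //=.
  have -> : y - w = (y0 - w) - (y0 - y) by ring.
  have := nmB (y0 - w) (y0 - y); rewrite -/r; lra.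
have h2 : \prod_(y <- ys) (3 * nm (y0 - y) + 2 * (b * T)) <=
    3 ^+ K * nm (ev F x y0) + 2 * (b * T) * M.
  have bT2 : 0 <= 2 * (b * T) by lra.
  have bTb : b * T <= b by rewrite ler_piMr //; lra.
  have Hu y : y \in ys -> 0 <= 3 * nm (y0 - y) <= U.
    move=> yys; have Fy : ev F x y = 0 by apply/eqP; rewrite Ey -[_ == 0]/(root _ _) root_prod_XsubC.
    have := HB 1 x y (lexx _) x1 Fy; have := nmB y0 y; have := nm_ge0 (y0 - y); rewrite /U; lra.
  apply: le_trans (prod_add_le bT2 Hu U0) _; rewrite sy.
  apply: lerD.
    rewrite (nm_ev_prod _ Ey) -sy.
    rewrite -[3 ^+ _](_ : \prod_(y <- ys) 3 = _); last by rewrite big_const_seq count_predT iter_mulr_1.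
    by rewrite -big_split.
  rewrite ler_wpM2l // lerXn2r ?nnegrE //; lra.
have := ler_wpM2l a0 (le_trans h1 h2); rewrite ev_polar nmM => h3; apply: le_trans h3 _.
set f := nm (ev F x y0); have f0 : 0 <= f by rewrite nm_ge0.
have h4 : 0 <= nm a * (2 * b * M) * (nm a * f) by rewrite !(mulr_ge0 aM) // mulr_ge0.
have h5 : 0 <= 3 ^+ K * T by rewrite mulr_ge0 //; lra.
lra.
Qed.
End PolarEstimates.

End Core.

(** * The inequality at a singular point *)

Section Core.
Variable R : rcfType.
Notation C := (R[i]).
Implicit Types (x y z t w : C) (p q : {poly C}) (P A F Q : {poly {poly C}}).

Definition grad_size P x y : R := nm (ev (dx P) x y) + nm (ev P^`() x y).

Lemma grad_size_ge0 P x y : 0 <= grad_size P x y.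
Proof. by rewrite addr_ge0 ?nm_ge0. Qed.

Lemma degle_dx K P : degle K.+1 P -> degle K (dx P).
Proof.
move=> H j; rewrite coef_map /=.
have := H j; have [->|n0] := eqVneq P`_j 0; first by rewrite deriv0 size_poly0.
have := lt_size_deriv n0; have aux (a b : nat) : (a < b -> b <= K.+2 - j -> a <= K.+1 - j)%N by lia.
exact: aux.
Qed.

Lemma fiber_root x y F (ys : seq C) : fiber x F = \prod_(y <- ys) ('X - y%:P) ->
  y \in ys -> ev F x y = 0.
Proof. by move=> -> ys0; apply/eqP; rewrite -[_ == 0]/(root _ _) root_prod_XsubC. Qed.

(** F is small at small points, hence so is r; the factor k lets the caller
    prescribe how small y1 has to be. *)
Lemma polar_foot F (K : nat) (k : R) : F \is monic -> size F = K.+1 -> (0 < K)%N ->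
  (F`_0)`_0 = 0 -> 1 <= k ->
  exists c : R, 1 <= c /\ forall x y0, c * nm x <= 1 -> c * nm y0 <= 1 ->
    exists ys y1, [/\ size ys = K, fiber x F = \prod_(y <- ys) ('X - y%:P), ev F x y1 = 0 &
      forall y, y \in ys -> nm (y0 - y1) <= nm (y0 - y)] /\
      [/\ nm (y0 - y1) ^+ K <= nm (ev F x y0), nm (y0 - y1) <= 1 & k * nm y1 <= 1].
Proof.
move=> mF sF K0 F00 k1; have [c9 [c91 H9]] := ev_near0 F.
pose q := (2 * k) ^+ K.
have k0 : 0 <= k by move: k1; clear; lra.
have q1 : 1 <= q by rewrite exprn_ege1 //; move: k1; clear; lra.
have q0 : 0 <= q by move: q1; clear; lra.
have qc : 1 <= q * c9 by apply: mul_ge1.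
exists (2 * (q * c9) + 2 * k); split; first by move: qc k1; clear; lra.
move=> x y0 Hx Hy.
have hqx : 2 * (q * c9) * nm x <= 1 by apply: cnm_mono Hx; move: k1; clear; lra.
have hqy : 2 * (q * c9) * nm y0 <= 1 by apply: cnm_mono Hy; move: k1; clear; lra.
have hky : 2 * k * nm y0 <= 1 by apply: cnm_mono Hy; move: qc; clear; lra.
have x1 : nm x <= 1 by apply: cnm_le1 hqx; move: qc; clear; lra.
have y01 : nm y0 <= 1 by apply: cnm_le1 hqy; move: qc; clear; lra.
have [ys [sy Ey]] := fiber_roots x mF sF.
have [y1 y1s near] : exists2 y1, y1 \in ys & forall y, y \in ys -> nm (y0 - y1) <= nm (y0 - y).
  by apply: nearest_root; rewrite sy.
exists ys, y1; split; first by split=> //; apply: fiber_root Ey y1s.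
set r := nm (y0 - y1) in near *; have r0 : 0 <= r by rewrite nm_ge0.
have rK : r ^+ K <= nm (ev F x y0).
  by rewrite (nm_ev_prod _ Ey) -sy; apply: exp_le_prod.
(* r^K <= |F(x,y0)| <= c9 (|x| + |y0|), compared through K-th powers. *)
have rsmall : 2 * k * r <= 1.
  rewrite -(@expr_le1 _ K) ?mulr_ge0 //.
  rewrite exprMn -/q; apply: le_trans (ler_wpM2l q0 rK) _.
  have := H9 x y0 x1 y01; rewrite F00 subr0 => h.
  apply: le_trans (ler_wpM2l q0 h) _; rewrite mulrA mulrDr.
  by move: hqx hqy; clear; lra.
split=> //.
  have : r <= k * r by rewrite ler_peMl.
  by move: rsmall r0; clear; lra.
have h1 : nm y1 <= nm y0 + r by have := nm_ler_sub y1 y0; rewrite nmBC -/r.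
by have := ler_wpM2l k0 h1; move: rsmall hky; clear; lra.
Qed.

(** The exponent n = dK + K^2 + 2 makes the approximation error |x|^n
    negligible against both gaps, |x|^(dK) and |x|^(K^2 + 1). *)
Lemma local_inequality_singular P F (a : C) (K m : nat) :
  a != 0 -> P^`() = a%:P%:P * F -> F \is monic -> size F = K.+1 -> (0 < K)%N ->
  degle K.+1 P -> degle K F -> (1 < m)%N -> ordge m P -> ordge m.-1 F -> (F`_m.-1)`_0 != 0 ->
  exists c : R, 1 <= c /\ forall x y, c * nm x <= 1 -> c * nm y <= 1 ->
    nm (ev P x y) ^+ (K * K) <= c * grad_size P x y ^+ (K * K).+1.
Proof.
move=> a0 PF mF sF K0 dP dF m1 oP oF Fm.
pose n := (K.+1 * K + K * K + 2)%N.
have P00 : (P`_0)`_0 = 0 by apply/eqP; apply: contraTT m1 => /oP; rewrite addn0 leqn0 => /eqP ->.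
have F00 : (F`_0)`_0 = 0 by apply/eqP; apply: contraTT m1 => /oF; rewrite addn0 leqn0; case: (m) => [|[]].
have mu0 : (0 < m.-1)%N by case: (m) m1 => [|[]].
have mun : (m.-1 <= n * K)%N.
  have : (m.-1 <= K)%N.
    by rewrite -ltnS -sF ltnNge; apply: contra Fm => /leq_sizeP ->; rewrite ?coef0.
  by move/leq_trans; apply; rewrite leq_pmull // /n addn2.
have n0 : (0 < n)%N by rewrite /n addn2.
have [c1 [c11 H1]] := root_gap mF sF dF (degle_dx dP).
have [c2 [c21 H2]] := root_gap mF sF dF dP.
have [c3 [c31 H3]] := polar_approx a0 PF mF sF oF Fm mu0 mun K0 n0 P00.
have [c9 [c91 H9]] := polar_foot mF sF K0 F00 c31.
have B2 : 1 <= 2 :> R by clear; lra.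
have [c4 [c41 H4]] := ev_lipschitz P B2.
have [c5 [c51 H5]] := ev_lipschitz (dx P) B2.
have [c6 [c61 H6]] := ev_lipschitz P^`() B2.
have [c7 [c71 H7]] := ev_bounded (dx P) (lexx 1).
have [c8 [c81 H8]] := ev_bounded P^`() (lexx 1).
have [c10 [c101 H10]] := taylor_maj_branch PF mF sF c31 dF.
have na0 : 0 < nm a by rewrite lt_def nm_eq0 a0 nm_ge0.
have [CT [CT1 [[CT_1 CT_2 CT_3 CT_4 CT_5] [CT_6 CT_7 CT_8 CT_9 CT_10]]]] :
    exists CT : R, 1 <= CT /\
     ([/\ c1 <= CT, c2 <= CT, c3 <= CT, c4 * c3 <= CT & c5 * c3 <= CT] /\
      [/\ c6 * c3 <= CT, c7 + c8 <= CT, c10 <= CT, 3 ^+ K <= CT & (nm a)^-1 <= CT]).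
  have p3 : 0 <= 3 ^+ K :> R by rewrite exprn_ge0.
  have ai0 : 0 <= (nm a)^-1 by rewrite invr_ge0 ltW.
  have m43 : 1 <= c4 * c3 by apply: mul_ge1.
  have m53 : 1 <= c5 * c3 by apply: mul_ge1.
  have m63 : 1 <= c6 * c3 by apply: mul_ge1.
  exists (c1 + c2 + c3 + c4 * c3 + c5 * c3 + c6 * c3 + (c7 + c8) + c10 + 3 ^+ K + (nm a)^-1).
  move: p3 ai0 m43 m53 m63 c11 c21 c31 c71 c81 c101; clear.
  move: (3 ^+ K) (nm a)^-1 (c4 * c3) (c5 * c3) (c6 * c3) => u1 u2 u3 u4 u5 *.
  by do !split; lra.
have C0 : 0 <= CT by move: CT1; clear; lra.
have C5 : 1 <= CT ^+ 5 by rewrite exprn_ege1.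
(* D1 measures how small x and y have to be, D2 is the final constant. *)
pose D1 := 10 * CT ^+ 5 + c9 + c3.
pose D2 := (3 * CT ^+ 2) ^+ (K * K) * (2 ^+ (K * K) * (4 * CT ^+ 3 * CT ^+ (2 * K))).
have D20 : 0 <= D2.
  by rewrite /D2 !(mulr_ge0, exprn_ge0).
have D11 : 1 <= D1 by rewrite /D1; move: C5 c91 c31; clear; lra.
exists (D1 + D2); split; first by move: D11 D20; clear; lra.
move=> x y0 hx hy.
have Hx : D1 * nm x <= 1 by apply: cnm_mono hx; rewrite lerDl.
have Hy : D1 * nm y0 <= 1 by apply: cnm_mono hy; rewrite lerDl.
have {hx hy} : D2 * grad_size P x y0 ^+ (K * K).+1 <= (D1 + D2) * grad_size P x y0 ^+ (K * K).+1.
  by rewrite ler_wpM2r ?exprn_ge0 ?grad_size_ge0 // lerDr; move: D11; clear; lra.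
apply: le_trans.
have x1 := cnm_le1 D11 Hx; have y01 := cnm_le1 D11 Hy.
have c9x : c9 * nm x <= 1 by apply: cnm_mono Hx; rewrite /D1; move: C5 c91 c31; clear; lra.
have c9y : c9 * nm y0 <= 1 by apply: cnm_mono Hy; rewrite /D1; move: C5 c91 c31; clear; lra.
have c3x : c3 * nm x <= 1 by apply: cnm_mono Hx; rewrite /D1; move: C5 c91 c31; clear; lra.
have Cx : 10 * CT ^+ 5 * nm x <= 1 by apply: cnm_mono Hx; rewrite /D1; move: c91 c31; clear; lra.
have C1x : CT * nm x <= 1.
  have CT5 : CT <= CT ^+ 5 by rewrite -[leLHS]expr1 ler_weXn2l.
  by apply: cnm_mono Cx; move: CT5 C5; clear; lra.
have c1x := cnm_mono CT_1 C1x; have c2x := cnm_mono CT_2 C1x.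
have [ys [y1 [[sy Ey Fy1 near] [rK r1 y1small]]]] := H9 x y0 c9x c9y.
have y11 := cnm_le1 c31 y1small.
have [w [y1w Hbr]] := H3 x y1 c3x y1small Fy1.
have gapg := H1 x y1 c1x Fy1; have gaph := H2 x y1 c2x Fy1.
clear H1 H2 H3 H9 D11 D20 Hx Hy D1 c1x c2x c9x c9y C1x.
set r := nm (y0 - y1) in near rK r1 *; have r0 : 0 <= r by rewrite nm_ge0.
set X := nm x in x1 Cx c3x y1w gapg gaph *; have X0 : 0 <= X by rewrite nm_ge0.
set T := X ^+ n in y1w *.
have T0 : 0 <= T by rewrite exprn_ge0.
have T1 : T <= 1 by rewrite exprn_ile1.
have TX : T <= X by rewrite /T; case: (n) n0 => // k _; rewrite exprS ler_piMr // exprn_ile1.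
have w2 : nm w <= 2.
  have := nm_ler_sub w y1; rewrite nmBC.
  have : c3 * T <= c3 * X by rewrite ler_wpM2l //; move: c31; clear; lra.
  move: y1w c3x y11; clear; lra.
set G := grad_size P x y0; set Fz := nm (ev P^`() x y0).
have Fz0 : 0 <= Fz by rewrite nm_ge0.
have FzG : Fz <= G by rewrite lerDr nm_ge0.
have G0 : 0 <= G by rewrite grad_size_ge0.
have GC : G <= CT by apply: le_trans CT_7; apply: lerD; [exact: H7|exact: H8].
have y12 : nm y1 <= 2 by move: y11; clear; lra.
(* Moduli at y1 and at the branch point w differ by a multiple of T. *)
have lip A (k : R) : 1 <= k -> k * c3 <= CT ->
    (forall x y y', nm x <= 1 -> nm y <= 2 -> nm y' <= 2 -> nm (ev A x y - ev A x y') <= k * nm (y - y')) ->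
    nm (ev A x y1) <= nm (ev A x w) + CT * T /\ nm (ev A x w) <= nm (ev A x y1) + CT * T.
  move=> k1 kc /(_ x y1 w x1 y12 w2) h1.
  have k0 : 0 <= k by move: k1; clear; lra.
  have h2 := ler_wpM2l k0 y1w.
  have h3 : k * (c3 * T) <= CT * T by rewrite mulrA ler_wpM2r.
  have h4 := nm_ler_sub (ev A x y1) (ev A x w).
  have h5 := nm_ler_sub (ev A x w) (ev A x y1); rewrite nmBC in h5.
  by move: h1 h2 h3 h4 h5; clear => *; split; lra.
have [hu _] := lip P c4 c41 CT_4 H4.
have [gv vg] := lip (dx P) c5 c51 CT_5 H5.
have [_ fT] := lip P^`() c6 c61 CT_6 H6.
rewrite (ev_polar PF x y1) Fy1 mulr0 nm0 add0r in fT.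
have rG : r ^+ K <= CT * G.
  have Ffz : nm (ev F x y0) = (nm a)^-1 * Fz.
    by rewrite /Fz (ev_polar PF) nmM mulKf // gt_eqF.
  rewrite Ffz in rK; apply: le_trans rK _.
  apply: (@le_trans _ _ (CT * Fz)); first by rewrite ler_wpM2r.
  by rewrite ler_wpM2l.
(* Vertical comparison of z0 with the foot y1 on the polar curve. *)
have pz : nm (ev P x y0) <= nm (ev P x y1) + CT * r * G.
  have t1 := nm_ler_sub (ev P x y0) (ev P x y1).
  have t2 := ev_taylor_maj P x y1 (y0 - y1); rewrite subrKC -/r in t2.
  have t3 := taylor_maj_root PF sy Ey near; rewrite -/r -/Fz in t3.
  have t4 : 3 ^+ K * r * Fz <= CT * r * Fz by rewrite ler_wpM2r // ler_wpM2r.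
  have t5 : CT * r * Fz <= CT * r * G by rewrite ler_wpM2l // mulr_ge0.
  by move: t1 t2 t3 t4 t5; clear; lra.
pose r' := nm (y0 - w); have r'r : r' <= r + CT * T.
  have t1 := nmD (y0 - y1) (y1 - w); rewrite subrKA -/r -/r' in t1.
  have t2 : c3 * T <= CT * T by rewrite ler_wpM2r.
  by move: t1 t2 y1w; clear; lra.
pose tp := taylor_maj P x w r'.
have tpb : tp <= CT * r' * (Fz + T).
  apply: le_trans (H10 x y0 y1 w T ys x1 y01 T0 T1 sy Ey near y1w) _.
  by rewrite -/r' -/Fz ler_wpM2r ?addr_ge0 // ler_wpM2r ?nm_ge0.
(* The branch estimate is used at z0 and, with rho = 0, at w itself. *)
have [] := branch_bounds_mono CT_3 Hbr (y0 - w).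
rewrite subrKC -/r' -/tp -/X -[_ + Fz]/G => A1 A2.
have [A3 _] := branch_bounds_mono CT_3 Hbr 0.
rewrite addr0 nm0 -/X in A3.
have tp00 : taylor_maj P x w 0 <= 0.
  by apply: le_trans (taylor_maj_le w (lexx 0) (fiber_polar PF Ey)) _; rewrite mul0r.
have {tp00} A3' : nm (ev P x w) <= CT * (X * (nm (ev (dx P) x w) + nm (ev P^`() x w))).
  apply: le_trans A3 _; rewrite ler_wpM2l //; move: tp00; clear; lra.
have tp2 := taylor_error_bound CT1 r0 r1 T0 T1 Fz0 FzG GC r'r tpb.
apply: (inequality_from_estimates K0 (erefl n) CT1 X0 x1 r0 G0 GC Cx _ _ rG pz hu gv vg fT tp2 A1 A2 A3'); rewrite ?nm_ge0 //.
- by case: gaph => [->|h]; [left; exact: nm0|right; exact: le_trans h (ler_wpM2r (nm_ge0 _) CT_2)].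
- by case: gapg => [->|h]; [left; exact: nm0|right; exact: le_trans h (ler_wpM2r (nm_ge0 _) CT_1)].
Qed.
End Core.

(** * From two variables to bivariate form *)

Section Shear.
Variable K : idomainType.
Implicit Types (f g : {mpoly K[2]}) (lam : K).

Definition shear_var lam (i : 'I_2) : {poly {poly K}} :=
  if i == ord0 then 'X%:P + lam%:P%:P * 'X else 'X.

Definition constp : {rmorphism K -> {poly {poly K}}} := polyC \o polyC.

(** f(x + lam y, y) in bivariate form; lam is chosen below so that the leading
    and the initial form of f do not vanish at (lam, 1). *)
Definition shear lam f : {poly {poly K}} := mmap constp (shear_var lam) f.

Lemma ev_shear lam f (z : 'I_2 -> K) :
  ev (shear lam f) (z ord0 - lam * z ord_max) (z ord_max) = f.@[z].
Proof.
set x := _ - _; set y := z ord_max.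
pose psi : {rmorphism {poly {poly K}} -> K} := horner_eval y \o map_poly (horner_eval x).
rewrite -[LHS]/(psi (shear lam f)) rmorph_mmap.
have evC p : ev (p%:P) x y = p.[x] by rewrite map_polyC hornerC.
apply: eq_mmap => [c|i].
  by rewrite -[LHS]/(ev (constp c) x y) evC hornerC.
rewrite -[LHS]/(ev (shear_var lam i) x y) /shear_var; case: eqP => [->|i0].
  rewrite evD evCM evC hornerX hornerC map_polyX hornerX.
  by rewrite /x /y; ring.
rewrite map_polyX hornerX /y; congr z; apply/val_inj => /=.
by case: i i0 => [[|[|i]] Hi] // []; apply/val_inj.
Qed.

(** Both partial derivatives obey the same chain rule, so it is proved for any
    derivation D over the constants: the polynomials satisfying it form a
    subring containing the constants and the variables. *)
Lemma shear_deriv (D : {additive {poly {poly K}} -> {poly {poly K}}}) lam f :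
  (forall P Q, D (P * Q) = D P * Q + P * D Q) -> (forall c, D (constp c) = 0) ->
  D (shear lam f) = \sum_(i < 2) D (shear_var lam i) * shear lam f^`M(i).
Proof.
move=> DM DC; pose S g := D (shear lam g) = \sum_(i < 2) D (shear_var lam i) * shear lam g^`M(i).
have SD g h : S g -> S h -> S (g + h).
  rewrite /S /shear => Sg Sh; rewrite rmorphD raddfD /= Sg Sh -big_split /=.
  by apply: eq_bigr => i _; rewrite mderivD rmorphD /= mulrDr.
have SM g h : S g -> S h -> S (g * h).
  rewrite /S /shear => Sg Sh; rewrite rmorphM DM /= Sg Sh mulr_suml mulr_sumr -big_split /=.
  by apply: eq_bigr => i _; rewrite mderivM rmorphD !rmorphM /=; ring.
have SC c : S (c%:MP).
  rewrite /S /shear mmapC DC big1 // => i _.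
  by rewrite mderivC rmorph0 mulr0.
have SX i : S ('X_i).
  rewrite /S /shear mmapX mmap1U (bigD1 i) //= mderivX big1 ?addr0 => [|j ji].
    rewrite mnm1E eqxx scale1r -[(U_(i) - U_(i))%MM](_ : 0%MM = _); last first.
      by apply/mnmP => k; rewrite mnmBE mnm0E subnn.
    by rewrite mpolyX0 rmorph1 mulr1.
  by rewrite mderivX mnm1E eq_sym (negPf ji) scale0r rmorph0 mulr0.
rewrite -/(S f) [f]mpolyE; elim/big_ind: _ => [|g h|m _].
- by have := SC 0; rewrite mpolyC0.
- exact: SD.
rewrite -mul_mpolyC; apply: (SM) => //; rewrite mpolyXE_id.
elim/big_ind: _ => [|g h|i _]; first by have := SC 1; rewrite mpolyC1.
  exact: SM.
elim: (m i) => [|k IH]; first by rewrite expr0; have := SC 1; rewrite mpolyC1.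
by rewrite exprS; apply: (SM).
Qed.

Lemma constpE c : constp c = c%:P%:P. Proof. by []. Qed.

Lemma shear_dx lam f : dx (shear lam f) = shear lam f^`M(ord0).
Proof.
rewrite (@shear_deriv (map_poly (@deriv K))) ?big_ord_recl ?big_ord0.
- have E0 : dx (shear_var lam ord0) = 1.
    by rewrite /shear_var eqxx raddfD /= dxM !dxC dxX mulr0 addr0 !derivC polyC0 mul0r addr0 derivX.
  have E1 : dx (shear_var lam (lift ord0 ord0)) = 0 by exact: dxX.
  by rewrite /= E0 E1 mul1r mul0r !addr0.
- exact: dxM.
by move=> c; apply: etrans (dxC c%:P) _; rewrite derivC polyC0.
Qed.

Lemma shear_dy lam f : (shear lam f)^`() =
  lam%:P%:P * shear lam f^`M(ord0) + shear lam f^`M(ord_max).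
Proof.
rewrite (@shear_deriv (@deriv {poly K})) ?big_ord_recl ?big_ord0.
- rewrite addr0 /shear_var /= derivD derivM !derivC derivX mul0r !add0r mulr1 mul1r.
  congr (_ + shear lam f^`M(_)); exact/val_inj.
- exact: derivM.
by move=> c; exact: derivC.
Qed.

Lemma ev_shear_dx lam f (z : 'I_2 -> K) :
  ev (dx (shear lam f)) (z ord0 - lam * z ord_max) (z ord_max) = (f^`M(ord0)).@[z].
Proof. by rewrite shear_dx ev_shear. Qed.

Lemma ev_shear_dy lam f (z : 'I_2 -> K) :
  ev (shear lam f)^`() (z ord0 - lam * z ord_max) (z ord_max) =
    lam * (f^`M(ord0)).@[z] + (f^`M(ord_max)).@[z].
Proof. by rewrite shear_dy evD evCM hornerC !ev_shear. Qed.

(** Homogeneity of degree s in the two variables. *)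
Definition bihomog s (P : {poly {poly K}}) := forall i j, (i + j)%N != s -> (P`_j)`_i = 0.

Lemma bihomogM s t P Q : bihomog s P -> bihomog t Q -> bihomog (s + t)%N (P * Q).
Proof.
move=> HP HQ i j ij; rewrite coefM coef_sum big1 // => k _.
rewrite coefM big1 // => l _.
case: (eqVneq (l + k)%N s) => [lk|lk]; last by rewrite HP ?mul0r.
rewrite HQ ?mulr0 //; apply: contraNneq ij => <-.
by have := ltn_ord k; have := ltn_ord l; rewrite -lk; lia.
Qed.

Lemma bihomogX s k P : bihomog s P -> bihomog (s * k)%N (P ^+ k).
Proof.
move=> H; elim: k => [|k IH]; last first.
  rewrite exprS (_ : s * k.+1 = s + s * k)%N; first exact: bihomogM.
  by rewrite mulnS.
move=> i j; rewrite muln0 expr0 coef1 addn_eq0; case: j => [|j] /=; rewrite ?coef0 //.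
by rewrite andbT mulr1n coef1 => /negPf ->.
Qed.

Lemma bihomog_shear_var lam i : bihomog 1 (shear_var lam i).
Proof.
have HX : bihomog 1 ('X : {poly {poly K}}).
  move=> k j kj; rewrite coefX; case: (j =P 1%N) kj => [->|_ _]; last by rewrite mulr0n coef0.
  by rewrite mulr1n coef1 addn1 eqSS => /negPf ->.
rewrite /shear_var; case: ifP => // _ k j kj.
rewrite coefD coefCM coefD coefCM (HX k j kj) mulr0 addr0 coefC.
case: (j =P 0%N) kj => [->|_ _]; last by rewrite coef0.
by rewrite addn0 coefX => /negPf ->.
Qed.

Lemma bihomog_mmap1 lam (m : 'X_{1..2}) : bihomog (mdeg m) (mmap1 (shear_var lam) m).
Proof.
rewrite mdegE /mmap1.
elim/big_ind2: _ => [|s P t Q|i _].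
- by have := @bihomogX 0 0 0; rewrite expr0; apply => i j _; rewrite coef0 coef0.
- exact: bihomogM.
by have := @bihomogX 1 (m i) _ (@bihomog_shear_var lam i); rewrite mul1n.
Qed.

Lemma shear_coef lam f i j : ((shear lam f)`_j)`_i != 0 ->
  exists2 m, m \in msupp f & mdeg m = (i + j)%N.
Proof.
have [/hasP [m mf /eqP dm] _|/hasPn H] := boolP (has (fun m => mdeg m == i + j)%N (msupp f)).
  by exists m.
case/eqP; rewrite /shear /mmap coef_sum coef_sum big_seq big1 // => m mf.
rewrite constpE !coefCM bihomog_mmap1 ?mulr0 //.
by rewrite eq_sym; apply: H.
Qed.

(** The homogeneous part of degree s of f, evaluated at (lam, 1) with lam the
    variable. *)
Definition form s f : {poly K} := \sum_(m <- msupp f | mdeg m == s) f@_m *: 'X^(m ord0).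

Lemma shear_form lam f s : ((shear lam f)`_s)`_0 = (form s f).[lam].
Proof.
have fC (c : {poly K}) : fiber (0 : K) c%:P = (c.[0])%:P by rewrite map_polyC.
have fM P Q : fiber (0 : K) (P * Q) = fiber 0 P * fiber 0 Q by exact: rmorphM.
have fD P Q : fiber (0 : K) (P + Q) = fiber 0 P + fiber 0 Q by exact: rmorphD.
have fE P k : fiber (0 : K) (P ^+ k) = fiber 0 P ^+ k by exact: rmorphXn.
have F0 : fiber 0 (shear_var lam ord0) = lam%:P * 'X.
  by rewrite /shear_var eqxx fD fM !fC map_polyX hornerX hornerC add0r.
have F1 : fiber 0 (shear_var lam (lift ord0 ord0)) = 'X by exact: map_polyX.
rewrite -horner_coef0 -coef_fiber.
rewrite /shear /mmap rmorph_sum coef_sum /form horner_sum [RHS]big_mkcond /=.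
apply: eq_bigr => m _.
have -> : fiber 0 (constp f@_m * mmap1 (shear_var lam) m) = (f@_m * lam ^+ m ord0)%:P * 'X^(mdeg m).
  rewrite fM constpE fC hornerC polyCM -mulrA; congr (_ * _).
  rewrite /mmap1 mdegE !big_ord_recl !big_ord0 mulr1 addn0 fM !fE F0 F1.
  by rewrite exprMn -polyC_exp -mulrA -exprD.
rewrite coefCM coefXn eq_sym; case: eqP => _; rewrite ?mulr0 ?mulr1 //.
by rewrite hornerZ hornerXn.
Qed.

(** Monomials of equal degree in two variables have distinct exponents of the
    first variable, so that no cancellation occurs. *)
Lemma form_neq0 f m : m \in msupp f -> form (mdeg m) f != 0.
Proof.
move=> mf; apply/eqP => /(congr1 (fun p : {poly K} => p`_(m ord0))).
rewrite coef0 coef_sum big_mkcond (bigD1_seq m mf (msupp_uniq f)) /=.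
rewrite eqxx coefZ coefXn eqxx mulr1 big1 ?addr0.
  by move=> f0; move: mf; rewrite mcoeff_msupp f0 eqxx.
move=> m' mm; case: eqP => // dm; rewrite coefZ coefXn; case: eqP => e; last by rewrite mulr0.
case/eqP: mm; apply/mnmP => i.
move: dm; rewrite !mdegE !big_ord_recl !big_ord0 !addn0 e => /addnI e2.
by case: (unliftP ord0 i) => [k ->|->] //; rewrite (ord1 k).
Qed.

End Shear.

(** * The gradient inequality *)

Section LocalInequality.
Variable R : rcfType.
Notation C := (R[i]).
Implicit Types (x y z t w : C) (p q : {poly C}) (P A F Q : {poly {poly C}}).

(** dP/dy has a nonzero limit at 0, so some k G is at least 1 there. *)
Lemma local_inequality_smooth P N : (P`_1)`_0 != 0 ->
  exists c : R, 1 <= c /\ forall x y, c * nm x <= 1 -> c * nm y <= 1 ->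
    nm (ev P x y) ^+ N <= c * grad_size P x y ^+ N.+1.
Proof.
move=> b0; have [c [c1 Hc]] := ev_near0 P^`().
have [M [M1 HM]] := ev_bounded P (lexx 1).
have Eb : (P^`()`_0)`_0 = (P`_1)`_0 by rewrite coef_deriv mulr1n.
set b := (P`_1)`_0 in b0 Eb.
have bp : 0 < nm b by rewrite lt_def nm_eq0 b0 nm_ge0.
pose k := 2 * (nm b)^-1; have k0 : 0 <= k by rewrite mulr_ge0 // invr_ge0 ltW.
have c0 : 0 <= c by move: c1; clear; lra.
have M0 : 0 <= M by move: M1; clear; lra.
have kN : 0 <= M ^+ N * k ^+ N.+1 by rewrite mulr_ge0 ?exprn_ge0.
have c2k : 0 <= 2 * c * k by rewrite mulr_ge0 // mulr_ge0.
exists (1 + 2 * c * k + M ^+ N * k ^+ N.+1); split; first by move: kN c2k; clear; lra.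
move=> x y Hx Hy.
have x1 : nm x <= 1 by rewrite -[nm x]mul1r; apply: cnm_mono Hx; move: kN c2k; clear; lra.
have y1 : nm y <= 1 by rewrite -[nm y]mul1r; apply: cnm_mono Hy; move: kN c2k; clear; lra.
have kx : 2 * c * k * nm x <= 1 by apply: cnm_mono Hx; move: kN c2k; clear; lra.
have ky : 2 * c * k * nm y <= 1 by apply: cnm_mono Hy; move: kN c2k; clear; lra.
have kb : k * nm b = 2 by rewrite /k -mulrA mulVf ?mulr1 // gt_eqF.
have h1 := Hc x y x1 y1; rewrite Eb nmBC in h1.
have h2 := nm_ler_sub b (ev P^`() x y).
have G0 := grad_size_ge0 P x y.
have FG : nm (ev P^`() x y) <= grad_size P x y by rewrite lerDr nm_ge0.
have kG : 1 <= k * grad_size P x y.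
  have := ler_wpM2l k0 (le_trans h2 (lerD FG h1)).
  by rewrite kb; move: kx ky; clear; lra.
apply: (@le_trans _ _ (M ^+ N * k ^+ N.+1 * grad_size P x y ^+ N.+1)).
  rewrite -mulrA -exprMn; apply: (@le_trans _ _ (M ^+ N)).
    by rewrite lerXn2r ?nnegrE ?nm_ge0 //; apply: HM.
  by rewrite ler_peMr ?exprn_ge0 // exprn_ege1.
by rewrite ler_wpM2r ?exprn_ge0 //; move: c2k; clear; lra.
Qed.

(** If m = 1 then dP/dy does not vanish at 0; otherwise normalize dP/dy to the
    monic F, which inherits the conditions on degree and order. *)
Lemma local_inequality P d m : (0 < m)%N ->
  (forall i j, (P`_j)`_i != 0 -> (m <= i + j <= d)%N) ->
  (P`_d)`_0 != 0 -> (P`_m)`_0 != 0 ->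
  exists c : R, 1 <= c /\ forall x y, c * nm x <= 1 -> c * nm y <= 1 ->
    nm (ev P x y) ^+ (d.-1 * d.-1) <= c * grad_size P x y ^+ (d.-1 * d.-1).+1.
Proof.
move=> m0 HP Pd Pm; case: (ltnP 1 m) => m1; last first.
  by apply: local_inequality_smooth; have -> : 1%N = m by apply/eqP; rewrite eqn_leq m0.
have md : (m <= d)%N by have := HP _ _ Pm; rewrite add0n => /andP [].
case: d HP Pd md => [|K] HP Pd md; first by move: (leq_trans m1 md).
rewrite -[K.+1.-1]/K.
have K0 : (0 < K)%N by move: (leq_trans m1 md).
have dP : degle K.+1 P.
  move=> j; apply/leq_sizeP => i ij; apply/eqP; apply: contraTT ij => /HP /andP [_ h].
  by rewrite -ltnNge; move: h; clear; lia.
have oP : ordge m P by move=> i j /HP /andP [].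
pose a : C := (P`_K.+1)`_0 *+ K.+1.
have a0 : a != 0 by rewrite mulrn_eq0 negb_or Pd.
have ai0 : a^-1 != 0 by rewrite invr_eq0.
pose F := a^-1%:P%:P * P^`().
have PF : P^`() = a%:P%:P * F.
  by rewrite /F mulrA -!polyCM divff // !polyC1 mul1r.
have Fc j : F`_j = a^-1 *: (P`_j.+1 *+ j.+1).
  by rewrite /F coefCM coef_deriv mul_polyC.
have Fci j i : (F`_j)`_i = a^-1 * ((P`_j.+1)`_i *+ j.+1) by rewrite Fc coefZ coefMn.
have PK1 : P`_K.+1 = ((P`_K.+1)`_0)%:P.
  by apply: size1_polyC; have := dP K.+1; rewrite subSn // subnn.
have FK : F`_K = 1.
  rewrite Fc PK1 -polyCMn -/a -mul_polyC -polyCM mulVf //.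
have sF : size F = K.+1.
  apply/eqP; rewrite eqn_leq; apply/andP; split; last first.
    by rewrite ltnNge; apply/negP => /leq_sizeP /(_ K (leqnn K)) /eqP; rewrite FK oner_eq0.
  apply/leq_sizeP => j Kj; rewrite Fc (_ : P`_j.+1 = 0) ?mul0rn ?scaler0 //.
  by apply/eqP; rewrite -size_poly_eq0 -leqn0; have := dP j.+1; rewrite (_ : K.+2 - j.+1 = 0)%N //; move: Kj; clear; lia.
have mF : F \is monic by rewrite monicE lead_coefE sF FK.
have nz j i : (F`_j)`_i != 0 -> (P`_j.+1)`_i != 0.
  by rewrite Fci; apply: contraNneq => ->; rewrite mul0rn mulr0.
have dF : degle K F.
  move=> j; apply/leq_sizeP => i ij; apply/eqP; apply: contraTT ij => /nz /HP /andP [_ h].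
  by rewrite -ltnNge; move: h; clear; lia.
have oF : ordge m.-1 F.
  by move=> i j /nz /oP; rewrite addnS; case: (m).
have Fm : (F`_m.-1)`_0 != 0.
  by rewrite Fci prednK // mulf_neq0 // mulrn_eq0 negb_or Pm -lt0n m0.
exact: local_inequality_singular a0 PF mF sF K0 dP dF m1 oP oF Fm.
Qed.

Lemma nonroot p : p != 0 -> exists x, p.[x] != 0.
Proof.
move=> p0; have s0 : (0 < size p)%N by rewrite size_poly_gt0.
(* In characteristic 0 there are more natural numbers than roots. *)
pose rs : seq C := [seq i%:R | i <- iota 0 (size p)].
have : ~~ all (root p) rs.
  have u : uniq rs.
    by rewrite map_inj_uniq ?iota_uniq // => i j /eqP; rewrite eqr_nat => /eqP.
  apply/negP => ar; have := max_poly_roots p0 ar u.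
  by rewrite size_map size_iota ltnn.
by case/allPn => x _ px; exists x.
Qed.

End LocalInequality.

Section Lojasiewicz.
Variable R : realType.
Notation C := (R[i]).

Lemma nm_le_l2norm n (v : 'I_n -> C) i : nm (v i) <= l2norm (@Normc.normc R) v.
Proof.
rewrite /l2norm -[nm (v i)]ger0_norm ?nm_ge0 // -sqrtr_sqr ler_wsqrtr //.
by rewrite (bigD1 i) //= lerDl sumr_ge0 // => j _; rewrite sqr_ge0.
Qed.

Lemma shear_gradient_le (lam a b : C) (g : R) : nm a <= g -> nm b <= g ->
  nm a + nm (lam * a + b) <= (1 + (1 + nm lam)) * g.
Proof.
move=> ag bg; have h1 := nmD (lam * a) b; rewrite nmM in h1.
by have h2 := ler_wpM2l (nm_ge0 lam) ag; lra.
Qed.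

Lemma l2norm_ge0 n (v : 'I_n -> C) : 0 <= l2norm (@Normc.normc R) v.
Proof. exact: sqrtr_ge0. Qed.

(** Taking (N+1)-th roots; for N = 0 both a ^+ 0 and the real power are 1, even
    at a = 0. *)
Lemma powR_root (a b c : R) (N : nat) : 0 <= a -> 0 <= b -> 1 <= c ->
  a ^+ N <= c * b ^+ N.+1 -> exp.powR a (N%:R / N.+1%:R) <= c * b.
Proof.
move=> a0 b0 c1 H; have c0 : 0 <= c by apply: le_trans c1.
have p0 : 0 <= exp.powR a (N%:R / N.+1%:R) by exact: exp.powR_ge0.
have E : exp.powR a (N%:R / N.+1%:R) ^+ N.+1 = a ^+ N.
  rewrite -[LHS]exp.powR_mulrn // -exp.powRrM divfK ?pnatr_eq0 //.
  exact: exp.powR_mulrn.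
rewrite -(@ler_pXn2r _ N.+1) ?nnegrE ?mulr_ge0 // E exprMn.
apply: le_trans H _; rewrite ler_wpM2r ?exprn_ge0 //.
by rewrite -[leLHS]expr1 ler_weXn2l.
Qed.

Lemma meval_0 (K : comNzRingType) n (f : {mpoly K[n]}) : f.@[fun _ => 0] = f@_0%MM.
Proof.
rewrite mevalE (eq_bigr (fun m => if m == 0%MM then f@_m else 0)); last first.
  move=> m _; case: eqP => [->|/eqP m0].
    by rewrite big1 ?mulr1 // => i _; rewrite mnm0E expr0.
  have /existsP [i mi] : [exists i, m i != 0%N].
    rewrite -negb_forall; apply: contra m0 => /forallP H.
    by apply/eqP/mnmP => i; rewrite mnm0E; apply/eqP.
  by rewrite (bigD1 i) //= expr0n (negPf mi) mul0r mulr0.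
have [mf|mf] := boolP (0%MM \in msupp f).
  rewrite (bigD1_seq _ mf (msupp_uniq f)) /= eqxx big1 ?addr0 // => m /negPf ->.
  by [].
rewrite big_seq big1 => [|m mS]; first by apply/esym/eqP; rewrite mcoeff_eq0.
by case: eqP => // m0; rewrite -m0 mS in mf.
Qed.

(** The parameter lam avoids the zeros of the forms of f of degree d and of
    the least degree m; then the sheared polynomial meets the hypotheses of
    local_inequality, and linear coordinate changes only affect constants. *)
Lemma complex_gradient_inequality (d : nat) (f : {mpoly C[2]}) :
  f != 0 -> msize f = d.+1 -> f.@[fun _ => 0] = 0 ->
  gradient_inequality (@Normc.normc R) f ((d.-1 * d.-1)%N%:R / (d.-1 * d.-1).+1%:R).
Proof.
move=> f0 sf fz.
have deg_pos m : m \in msupp f -> (0 < mdeg m)%N.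
  move=> mf; rewrite lt0n mdeg_eq0; apply: contraTneq mf => ->.
  by rewrite mcoeff_msupp negbK -meval_0 fz.
have deg_le m : m \in msupp f -> (mdeg m <= d)%N.
  by move/msize_mdeg_lt; rewrite sf.
have md : mdeg (mlead f) = d by apply: succn_inj; rewrite mlead_deg.
pose hasdeg k := has (fun m => mdeg m == k) (msupp f).
have exd : exists k, hasdeg k.
  by exists d; apply/hasP; exists (mlead f); rewrite ?mlead_supp ?md.
case: (ex_minnP exd) => m /hasP [m1 m1f /eqP m1d] mmin.
have m0 : (0 < m)%N by rewrite -m1d deg_pos.
have fd : form d f != 0 by rewrite -md form_neq0 // mlead_supp.
have fm : form m f != 0 by rewrite -m1d form_neq0.
have [lam] := nonroot (mulf_neq0 fd fm); rewrite hornerM mulf_eq0 negb_or => /andP [ld lm].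
have [|||c [c1 Hc]] := @local_inequality R (shear lam f) d m m0; rewrite ?shear_form //.
  move=> i j /shear_coef [m2 m2f <-]; rewrite deg_le // andbT mmin //.
  by apply/hasP; exists m2.
set N := (d.-1 * d.-1)%N in Hc *.
pose L := 1 + nm lam.
have L1 : 1 <= L by rewrite lerDl nm_ge0.
have cL1 : 1 <= c * L by apply: mul_ge1.
have c0 : 0 <= c by apply: le_trans c1.
have L0 : 0 <= L by apply: le_trans L1.
pose M := c * (1 + L) ^+ N.+1.
have M1 : 1 <= M by apply: mul_ge1 => //; rewrite exprn_ege1 // lerDl.
exists M^-1, (c * L)^-1; split.
- by rewrite invr_gt0; apply: lt_le_trans M1.
- by rewrite invr_gt0; apply: lt_le_trans cL1.
move=> z zs.
pose y := z ord_max; pose x := z ord0 - lam * y.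
have zL : c * L * l2norm (@Normc.normc R) z <= 1.
  have cL0 : 0 < c * L by apply: lt_le_trans cL1.
  by move: zs; rewrite -div1r ltr_pdivlMr // mulrC => /ltW.
have xL : nm x <= L * l2norm (@Normc.normc R) z.
  apply: le_trans (nmB _ _) _; rewrite nmM mulrDl mul1r; apply: lerD; first exact: nm_le_l2norm.
  by rewrite ler_wpM2l ?nm_ge0 // nm_le_l2norm.
have yL : nm y <= L * l2norm (@Normc.normc R) z.
  by apply: le_trans (nm_le_l2norm z _) _; rewrite ler_peMl ?l2norm_ge0.
have cx : c * nm x <= 1 by apply: le_trans zL; rewrite -mulrA ler_wpM2l.
have cy : c * nm y <= 1 by apply: le_trans zL; rewrite -mulrA ler_wpM2l.
have := Hc x y cx cy; rewrite {1}/x {1}/y ev_shear.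
set g := l2norm _ _ => H.
have g0 : 0 <= g by apply: l2norm_ge0.
have gb : grad_size (shear lam f) x y <= (1 + L) * g.
  have -> : grad_size (shear lam f) x y = nm (f^`M(ord0)).@[z] + nm (lam * (f^`M(ord0)).@[z] + (f^`M(ord_max)).@[z]).
    by rewrite -ev_shear_dy -(ev_shear_dx lam).
  exact: shear_gradient_le (nm_le_l2norm (gradient f z) ord0) (nm_le_l2norm (gradient f z) ord_max).
rewrite mulrC ler_pdivrMr ?(lt_le_trans _ M1) // [leRHS]mulrC.
apply: powR_root => //; first exact: nm_ge0.
apply: le_trans H _; rewrite /M -mulrA -exprMn ler_wpM2l //.
by rewrite lerXn2r ?nnegrE ?grad_size_ge0 // mulr_ge0 // addr_ge0.
Qed.

Lemma map_mpoly_meval n (f : {mpoly R[n]}) (z : 'I_n -> R) :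
  (map_mpoly (real_complex R) f).@[fun i => ((z i)%:C)%C] = ((f.@[z])%:C)%C.
Proof.
pose rc : {rmorphism R -> C} := real_complex R.
pose evz : {rmorphism {mpoly C[n]} -> C} := meval (fun i => rc (z i)).
have -> : ((f.@[z])%:C)%C = mmap (rc \o idfun) (rc \o z) f by exact: rmorph_mmap.
apply: etrans (rmorph_mmap _ evz _ f) _.
apply: eq_mmap => [c|i] /=; [exact: mevalC|exact: mevalXU].
Qed.

Lemma mderiv_map n (f : {mpoly R[n]}) i :
  (map_mpoly (real_complex R) f)^`M(i) = map_mpoly (real_complex R) f^`M(i).
Proof.
apply/mpolyP => m; rewrite mcoeff_deriv !mcoeff_map_mpoly mcoeff_deriv /=.
by rewrite rmorphMn.
Qed.

Lemma nm_real (a : R) : nm (a%:C)%C = `|a|.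
Proof. by rewrite /Normc.normc /= expr0n addr0 sqrtr_sqr. Qed.

Lemma l2norm_real n (v : 'I_n -> R) :
  l2norm (@Normc.normc R) (fun i => ((v i)%:C)%C) = l2norm (fun a : R => `|a|) v.
Proof. by rewrite /l2norm; congr Num.sqrt; apply: eq_bigr => i _; rewrite nm_real. Qed.

Lemma gradient_inequality_real n (f : {mpoly R[n]}) (l : R) :
  gradient_inequality (@Normc.normc R) (map_mpoly (real_complex R) f) l ->
  gradient_inequality (fun a : R => `|a|) f l.
Proof.
move=> [c [eps [c0 e0 H]]]; exists c, eps; split=> // z zs.
have := H (fun i => ((z i)%:C)%C); rewrite l2norm_real => /(_ zs).
rewrite map_mpoly_meval nm_real; congr (_ <= _).
rewrite -l2norm_real /l2norm; congr Num.sqrt; apply: eq_bigr => i _.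
by rewrite /gradient mderiv_map map_mpoly_meval.
Qed.

Lemma exponentE d : (0 < d)%N ->
  (d.-1 * d.-1)%N%:R / (d.-1 * d.-1).+1%:R = 1 - 1 / ((d%:R - 1) ^+ 2 + 1) :> R.
Proof.
case: d => // d _; have -> : d.+1%:R - 1 = d%:R :> R by rewrite -natr1 addrK.
rewrite -[d.+1.-1]/d -natr1 natrM -expr2.
have : (d%:R ^+ 2 + 1 : R) != 0 by rewrite gt_eqF // ltr_wpDl // sqr_ge0.
by move=> h; field.
Qed.

End Lojasiewicz.

(* [msize f] is the total degree of f plus one (for f nonzero). *)
Theorem theorem4p9 (R : realType) :
  (forall (d : nat) (f : {mpoly R[i][2]}),
      f != 0 -> msize f = d.+1 -> f.@[fun _ => 0] = 0 ->
      forall L : R, is_lojasiewicz_exponent (@Normc.normc R) f L ->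
        L <= 1 - 1 / ((d%:R - 1) ^+ 2 + 1))
  /\
  (forall (d : nat) (f : {mpoly R[2]}),
      f != 0 -> msize f = d.+1 -> f.@[fun _ => 0] = 0 ->
      forall L : R, is_lojasiewicz_exponent (fun x : R => `|x|) f L ->
        L <= 1 - 1 / ((d%:R - 1) ^+ 2 + 1)).
Proof.
have dpos (K : comNzRingType) d (f : {mpoly K[2]}) :
    f != 0 -> msize f = d.+1 -> f.@[fun _ => 0] = 0 -> (0 < d)%N.
  move=> f0 sf fz; rewrite lt0n; apply: contraNneq f0 => d0.
  have := @msize1_polyC _ _ f; rewrite sf d0 => /(_ isT) ->.
  by rewrite -meval_0 fz mpolyC0.
have l0 d : 0 <= (d.-1 * d.-1)%N%:R / (d.-1 * d.-1).+1%:R :> R by rewrite divr_ge0.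
split=> d f f0 sf fz L [_ _ Lmin]; rewrite -(exponentE R (dpos _ _ _ f0 sf fz)); apply: Lmin => //.
  exact: complex_gradient_inequality.
apply: gradient_inequality_real; apply: complex_gradient_inequality.
- apply: contra f0 => /eqP/mpolyP H; apply/eqP/mpolyP => m.
  by have := H m; rewrite mcoeff_map_mpoly !mcoeff0 => /complexI.
- by rewrite -sf !msizeE; apply: perm_big; apply: msupp_map_mpoly; exact: complexI.
by have := map_mpoly_meval f (fun=> 0); rewrite fz.
Qed.
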